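(* Let $p\in[1,\infty]$, let $\alpha$ be a real number and let $\omega\in\mathcal W_\alpha$. Let $\psi:[0,1]\to[0,\infty)$ be measurable and let $s:[0,1]\to\mathbb R$ be a measurable function such that $|s(t)|\ge t^\beta$ for a.e. $t\in[0,1]$, for some constant $\beta>0$. Then $U_{\psi,s}:L^p(\omega)\to L^p(\omega)$ exists as a bounded operator if and only if $$\int_0^1|s(t)|^{-\frac{n+\alpha}{p}}\psi(t)\,dt<\infty.$$ Moreover, when this condition holds, the operator norm of $U_{\psi,s}$ on $L^p(\omega)$ is given by $$\|U_{\psi,s}\|_{L^p(\omega)\to L^p(\omega)}=\int_0^1|s(t)|^{-\frac{n+\alpha}{p}}\psi(t)\,dt .$$
   Context: Fix an integer $n\ge 1$. $S_n=\{x\in\mathbb R^n:|x|=1\}$ with surface measure $\sigma$; when $n=1$, $\int_{S_n}\omega\,d\sigma$ means $2\omega(1)$. For $\alpha\in\mathbb R$, $\mathcal W_\alpha$ is the set of all measurable functions $\omega$ on $\mathbb R^n$ with $\omega(x)>0$ for a.e. $x$, $0<\int_{S_n}\omega(y)\,d\sigma(y)<\infty$, and $\omega(tx)=|t|^\alpha\omega(x)$ for all $t\in\mathbb R\setminus\{0\}$, $x\in\mathbb R^n$. For measurable $\psi:[0,1]\to[0,\infty)$ and $s:[0,1]\to\mathbb R$, the generalized Hardy-Cesàro operator is $U_{\psi,s}f(x)=\int_0^1 f(s(t)x)\psi(t)\,dt$ for measurable complex-valued $f$ on $\mathbb R^n$. $L^p(\omega)$ is the space of measurable $f$ with $\|f\|_{L^p(\omega)}=\left(\int_{\mathbb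 R^n}|f(x)|^p\omega(x)\,dx\right)^{1/p}<\infty$ (essential supremum norm if $p=\infty$). When $p=\infty$, the exponent $(n+\alpha)/p$ is read as $0$. *)

(* Defs.v *)
From HB Require Import structures.
From mathcomp Require Import all_boot all_order all_algebra.
From mathcomp Require Import all_classical all_reals all_analysis.
From mathcomp Require Import measurable_realfun ess_sup_inf complex.
Set Implicit Arguments.
Unset Strict Implicit.
Unset Printing Implicit Defensive.
Import Order.TTheory GRing.Theory Num.Theory.
Import numFieldNormedType.Exports.
Local Open Scope classical_set_scope.
Local Open Scope ring_scope.

Notation borelRn R n := (n.-tuple (measurableTypeR R)).

Section borel_lebesgue.
Variable R : realType.

Definition tcons n (z : measurableTypeR R * borelRn R n) : borelRn R n.+1 :=
  [tuple of z.1 :: z.2].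

Lemma measurable_tcons n : measurable_fun setT (@tcons n).
Proof. exact: measurable_cons. Qed.

Definition lebesgue_step n
    (mu : {sigma_finite_measure set (borelRn R n) -> \bar R}) :
    set (borelRn R n.+1) -> \bar R :=
  pushforward (@lebesgue_measure R \x mu)%E (@tcons n).

Section step.
Variables (n : nat) (mu : {sigma_finite_measure set (borelRn R n) -> \bar R}).

Let step0 : lebesgue_step mu set0 = 0%E.
Proof. by rewrite /lebesgue_step /pushforward preimage_set0 measure0. Qed.

Let step_ge0 A : (0 <= lebesgue_step mu A)%E.
Proof.
exact: (@measure_ge0 _ _ _ (@lebesgue_measure R \x mu)%E).
Qed.

Let step_sigma_additive : semi_sigma_additive (lebesgue_step mu).
Proof.
move=> F mF tF mUF; rewrite /lebesgue_step /pushforward preimage_bigcup.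
have mpre (A : set (borelRn R n.+1)) : measurable A ->
    measurable (@tcons n @^-1` A).
  by move=> mA; rewrite -[X in measurable X]setTI; exact: measurable_tcons.
apply: measure_semi_sigma_additive.
- by move=> i; exact: mpre.
- apply/trivIsetP => /= i j _ _ ij; rewrite -preimage_setI.
  by move/trivIsetP : tF => /(_ _ _ _ _ ij) ->//; rewrite preimage_set0.
- by rewrite -preimage_bigcup; exact: mpre.
Qed.

HB.instance Definition _ := isMeasure.Build _ _ _ (lebesgue_step mu)
  step0 step_ge0 step_sigma_additive.

Let step_sigma_finite : sigma_finite setT (lebesgue_step mu).
Proof.
have /sigma_finiteP[F [TF ndF Foo]] := sigma_finiteT (@lebesgue_measure R).
have /sigma_finiteP[G [TG ndG Goo]] := sigma_finiteT mu.
pose tl (x : borelRn R n.+1) : borelRn R n := [tuple of behead x].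
pose hd (x : borelRn R n.+1) : measurableTypeR R := thead x.
have mhd : measurable_fun setT hd by exact: measurable_tnth.
have mtl : measurable_fun setT tl by exact: measurable_behead.
exists (fun i => hd @^-1` F i `&` tl @^-1` G i).
  apply/esym/seteqP; split=> // x _.
  have [i _ Fi] : (\bigcup_i F i) (hd x) by rewrite -TF.
  have [j _ Gj] : (\bigcup_i G i) (tl x) by rewrite -TG.
  exists (maxn i j) => //; split.
    have /subsetPset FF := ndF _ _ (leq_maxl i j); exact: FF.
  have /subsetPset GG := ndG _ _ (leq_maxr i j); exact: GG.
move=> i; have [mF Fi] := Foo i; have [mG Gi] := Goo i; split.
  by apply: measurableI; rewrite -[X in measurable X]setTI; [exact: mhd|exact: mtl].
rewrite /lebesgue_step /pushforward.
rewrite (_ : _ @^-1` _ = F i `*` G i); last first.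
  apply/seteqP; split=> -[u t] [/= Fu Gt]; split=> //=.
    by move: Gt; rewrite (_ : tl _ = t)//; exact/val_inj.
  by rewrite /preimage/= (_ : tl _ = t)//; exact/val_inj.
by rewrite product_measure1E// lte_mul_pinfty// ge0_fin_numE.
Qed.

HB.instance Definition _ := Measure_isSigmaFinite.Build _ _ _
  (lebesgue_step mu) step_sigma_finite.
End step.

(* The n-fold product of the Lebesgue measure of the line, on Borel sets. *)
Fixpoint borel_lebesgue n : {sigma_finite_measure set (borelRn R n) -> \bar R} :=
  match n with
  | 0 => [the {sigma_finite_measure set (borelRn R 0) -> \bar R}
          of \d_([tuple] : borelRn R 0)]
  | m.+1 => [the {sigma_finite_measure set (borelRn R m.+1) -> \bar R}
             of lebesgue_step (borel_lebesgue m)]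
  end.

End borel_lebesgue.
Arguments borel_lebesgue {R} n.

(* [caratheodory_type] equips the same carrier with the Lebesgue-measurable
   sets, i.e. the completion of the Borel sets. *)
Notation Rn R n := (caratheodory_type ((@borel_lebesgue R n)^*)%mu).
Notation Rline R :=
  (caratheodory_type (((wlength idfun : set (ocitv_type R) -> \bar R)^*)%mu)).

Section definitions.
Context {R : realType}.

Definition lebesgueRn n : {measure set (Rn R n) -> \bar R} :=
  @completed_measure_extension _ _ _ (borel_lebesgue n).

Definition leb1 : {measure set (Rline R) -> \bar R} :=
  @completed_lebesgue_measure R.

Definition unit_itv : set (Rline R) := `[0%R, 1%R]%classic.

Definition enorm n (x : n.-tuple R) : R :=
  Num.sqrt (\sum_(i < n) tnth x i ^+ 2).

Definition tscale n (a : R) (x : n.-tuple R) : n.-tuple R :=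
  [tuple a * tnth x i | i < n].

Lemma measurable_enorm n :
  measurable_fun setT (@enorm n : borelRn R n -> measurableTypeR R).
Proof.
apply: (measurableT_comp (f := @Num.sqrt R : measurableTypeR R -> _)).
  by apply: continuous_measurable_fun; exact: sqrt_continuous.
apply: measurable_sum => i; apply: measurable_funX.
exact: measurable_tnth.
Qed.

Lemma measurable_closed_ball n :
  measurable ([set x | enorm x <= 1] : set (borelRn R n)).
Proof.
rewrite -[X in measurable X]setTI.
have m1 : measurable (`]-oo, 1]%classic : set (measurableTypeR R)) by [].
have := @measurable_enorm n measurableT _ m1.
by rewrite set_itvE.
Qed.

Definition radial_proj n (x : borelRn R n) : borelRn R n :=
  tscale (enorm x)^-1 x.

Lemma measurable_radial_proj n : measurable_fun setT (@radial_proj n).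
Proof.
apply/measurable_fun_tnthP => i.
rewrite (_ : _ \o _ = fun x : borelRn R n => enorm x `^ (-1) * tnth x i).
  apply: measurable_funM; last exact: measurable_tnth.
  apply: (measurableT_comp (f := fun r : measurableTypeR R => r `^ (-1))).
    exact: measurable_powR.
  exact: measurable_enorm.
apply/funext => x; rewrite /radial_proj /tscale /= tnth_mktuple.
by rewrite powR_inv1// sqrtr_ge0.
Qed.

(* Polar-coordinates (cone) definition of the surface measure of S_n: for A in
   S_n, sigma(A) = n * |{r a : a in A, 0 <= r <= 1}|. *)
Definition surface_measure n (A : set (borelRn R n)) : \bar R :=
  (n%:R%:E * borel_lebesgue n [set x | (enorm x <= 1)%R /\ A (radial_proj x)])%E.

Section surface_measure_is_measure.
Variable n : nat.

Let proj_measurable (A : set (borelRn R n)) : measurable A ->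
  measurable [set x : borelRn R n | enorm x <= 1 /\ A (radial_proj x)].
Proof.
move=> mA; apply: measurableI; first exact: measurable_closed_ball.
by rewrite -[X in measurable X]setTI; exact: measurable_radial_proj.
Qed.

Let surface0 : @surface_measure n set0 = 0%E.
Proof.
rewrite /surface_measure (_ : [set _ | _] = set0) ?measure0 ?mule0//.
by apply/seteqP; split=> // x [].
Qed.

Let surface_ge0 A : (0 <= @surface_measure n A)%E.
Proof. by rewrite /surface_measure mule_ge0// lee_fin. Qed.

Let surface_sigma_additive : semi_sigma_additive (@surface_measure n).
Proof.
move=> F mF tF mUF; rewrite /surface_measure.
under eq_fun do rewrite -ge0_sume_distrr//.
apply: cvgeZl => //.
rewrite (_ : [set _ | _] =
    \bigcup_i [set x | enorm x <= 1 /\ F i (radial_proj x)]); last first.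
  apply/seteqP; split=> x.
    by move=> [x1 [i _ Fi]]; exists i.
  by move=> [i _ [x1 Fi]]; split=> //; exists i.
apply: measure_semi_sigma_additive.
- by move=> i; exact: proj_measurable.
- apply/trivIsetP => i j _ _ ij; apply/seteqP; split=> // x [[_ Fi] [_ Fj]].
  have FF : F i `&` F j = set0 by move/trivIsetP : tF; apply.
  have : (F i `&` F j) (radial_proj x) by split.
  by rewrite FF.
- by apply: bigcupT_measurable => i; exact: proj_measurable.
Qed.

HB.instance Definition _ := isMeasure.Build _ _ _ (@surface_measure n)
  surface0 surface_ge0 surface_sigma_additive.

End surface_measure_is_measure.

Definition sphere n : set (n.-tuple R) := [set x | enorm x = 1].

(* In dimension one the integral over S_n is 2 w(1) by convention. *)
Definition sphere_integral n (w : n.-tuple R -> R) : \bar R :=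
  if n == 1%N then (2 * w [tuple 1 | _ < n])%:E
  else (\int[@completed_measure_extension _ _ _ (@surface_measure n)]_(y in
          @sphere n) (w y)%:E)%E.

(* The class W_alpha. *)
Definition homogeneous_weight n (alpha : R) (w : n.-tuple R -> R) : Prop :=
  [/\ measurable_fun setT (w : Rn R n -> measurableTypeR R),
      {ae lebesgueRn n, forall x, 0 < w x},
      (0 < sphere_integral w < +oo)%E
    & forall (t : R) (x : n.-tuple R),
        t != 0 -> w (tscale t x) = `|t| `^ alpha * w x].

Definition cmeasurable_fun d (T : measurableType d) (D : set T)
    (f : T -> R[i]) : Prop :=
  measurable_fun D (fun x => complex.Re (f x) : measurableTypeR R) /\
  measurable_fun D (fun x => complex.Im (f x) : measurableTypeR R).

(* The case -oo is junk: only exponents p >= 1 are used. *)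
Definition Lp_norm n (w : n.-tuple R -> R) (p : \bar R)
    (f : n.-tuple R -> R[i]) : \bar R :=
  match p with
  | r%:E => ((\int[lebesgueRn n]_x (Normc.normc (f x) `^ r * w x)%:E) `^ r^-1)%E
  | +oo%E => ess_sup (lebesgueRn n) (fun x => (Normc.normc (f x))%:E)
  | -oo%E => 0%E
  end.

Definition Lp n (w : n.-tuple R -> R) (p : \bar R) : set (n.-tuple R -> R[i]) :=
  [set f | cmeasurable_fun setT (f : Rn R n -> R[i]) /\ (Lp_norm w p f < +oo)%E].

Definition cintegrable d (T : measurableType d)
    (mu : {measure set T -> \bar R}) (D : set T) (f : T -> R[i]) : Prop :=
  mu.-integrable D (fun t => (complex.Re (f t))%:E) /\
  mu.-integrable D (fun t => (complex.Im (f t))%:E).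

Definition cintegral d (T : measurableType d)
    (mu : {measure set T -> \bar R}) (D : set T) (f : T -> R[i]) : R[i] :=
  Complex (\int[mu]_(t in D) complex.Re (f t)) (\int[mu]_(t in D) complex.Im (f t)).

Section hardy_cesaro.
Variables (n : nat) (psi s : R -> R).

Definition hc_integrand (f : n.-tuple R -> R[i]) (x : n.-tuple R) (t : Rline R) :
    R[i] :=
  f (tscale (s t) x) * (psi t)%:C%C.

Definition hardy_cesaro (f : n.-tuple R -> R[i]) (x : n.-tuple R) : R[i] :=
  cintegral leb1 unit_itv (hc_integrand f x).

Variables (w : n.-tuple R -> R) (p : \bar R).

(* [hardy_cesaro] maps L^p(w) to itself, the defining integral converging
   absolutely for a.e. x, and is bounded. Linearity, and independence of the
   representative of f, are consequences. *)
Definition hc_bounded : Prop :=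
  (forall f, Lp w p f ->
     {ae lebesgueRn n, forall x, cintegrable leb1 unit_itv (hc_integrand f x)} /\
     Lp w p (hardy_cesaro f)) /\
  exists C : R, forall f, Lp w p f ->
     (Lp_norm w p (hardy_cesaro f) <= C%:E * Lp_norm w p f)%E.

Definition hc_opnorm : \bar R :=
  ereal_sup [set Lp_norm w p (hardy_cesaro f) |
              f in [set f | Lp w p f /\ (Lp_norm w p f <= 1)%E]].

End hardy_cesaro.

Definition hc_exponent (n : nat) (alpha : R) (p : \bar R) : R :=
  match p with r%:E => (n%:R + alpha) / r | _ => 0 end.

Definition hc_constant (n : nat) (alpha : R) (p : \bar R) (psi s : R -> R) :
    \bar R :=
  (\int[leb1]_(t in unit_itv) (`|s t| `^ (- hc_exponent n alpha p) * psi t)%:E)%E.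

End definitions.

(* Main.v *)
Require Import Defs.
From HB Require Import structures.
From mathcomp Require Import all_boot all_order all_algebra.
From mathcomp Require Import all_classical all_reals all_analysis.
From mathcomp Require Import measurable_realfun ess_sup_inf complex.
From mathcomp Require Import ring lra.
Import Order.TTheory GRing.Theory Num.Theory.
Import numFieldNormedType.Exports.
Local Open Scope classical_set_scope.
Local Open Scope ring_scope.
Set Implicit Arguments.
Unset Strict Implicit.
Local Notation normc := Normc.normc.

(** Write gamma = (n + alpha) / p, with gamma = 0 for p = oo, and let K be the
    integral of |s|^-gamma psi over [0, 1].  Dilating a function f by a <> 0
    multiplies its norm in L^p(w) by |a|^-gamma, because w is homogeneous of
    degree alpha and Lebesgue measure has degree n.

    Upper bound.  U f is an average of the dilates of f, so its norm is at
    most K times that of f.  For finite p this is obtained from Jensen's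
    inequality for the measure |s|^-gamma psi dt of total mass K
    ([integral_powR_le]), followed by Tonelli and the dilation rule
    ([averaging_bound]); for p = oo a bound off a null set is passed under the
    integral sign, since for almost every x the orbit t |-> s(t) x meets that
    null set only for a null set of parameters ([ae_avoid]).  Tonelli is
    applied to Borel functions: a Lebesgue-measurable function is replaced by
    a Borel function equal to it off a Borel null set ([ae_representative]),
    and [ae_avoid] shows that U does not see the difference, provided that s
    does not vanish ([hardy_cesaro_representative]).  That s is almost
    everywhere nonzero is what |s(t)| >= t^beta is used for.

    Lower bound.  For p = oo the constant function 1 is an eigenfunction.  For
    p = r finite, |x|^-gamma would be an eigenfunction with eigenvalue K if it
    were in L^r(w).  It is therefore cut off to a shell 1 <= |x| < q^(m+2), and
    also to the cone where w(x) <= k |x|^alpha, which makes the norm finite by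
    a direct bound of the density.  The cone is invariant under nonzero
    dilations, so the mass of |x|^-(n+alpha) w on a shell q^i <= |x| < q^(i+1) does not
    depend on i ([shell_mass_scale]), and the r-th power of the norm of the
    cut-off function is proportional to the number m + 2 of these shells.
    Let K_q be the part of K coming from 1/q <= |s| <= q.  On the m inner
    shells the image is at least K_q times the function itself, so U has norm
    at least K_q (m/(m+2))^(1/r) ([truncated_ratio]).  Letting m and then q
    tend to infinity bounds K by any bound of U, which gives both the value of
    the norm and the necessity of K < oo. *)

(** * Borel representatives of Lebesgue-measurable functions *)

Section hull.
Context d (T : measurableType d) (R : realType).
Variable mu : {measure set T -> \bar R}.
Local Open Scope ereal_scope.

(** An intersection of covers whose total masses tend to the infimum that
    defines the outer measure. *)
Lemma mu_ext_hull (X : set T) :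
  exists2 B, measurable B /\ X `<=` B & mu B = (mu^*)%mu X.
Proof.
have [Xoo|] := eqVneq ((mu^*)%mu X) +oo.
  exists setT; first by split.
  apply/eqP; rewrite Xoo -leye_eq -Xoo -(measurable_mu_extE mu)//.
  exact: (@le_mu_ext _ _ _ mu).
rewrite -ltey => Xoo.
have Xfin : (mu^*)%mu X \is a fin_num by rewrite ge0_fin_numE// mu_ext_ge0.
have cov (k : nat) : exists B : set T, [/\ measurable B, X `<=` B &
    mu B <= (mu^*)%mu X + k.+1%:R^-1%:E].
  have k0 : (0 < k.+1%:R^-1 :> R)%R by rewrite invr_gt0.
  have [_ [A [mA XA] <-] lt] := lb_ereal_inf_adherent k0 Xfin.
  exists (\bigcup_i A i); split => //; first exact: bigcupT_measurable.
  apply: le_trans (ltW lt).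
  rewrite -(measurable_mu_extE mu); last exact: bigcupT_measurable.
  by apply: ereal_inf_lbound; exists A => //; split.
have [B BP] := choice cov.
exists (\bigcap_k B k).
  split; first by apply: bigcapT_measurable => k; have [] := BP k.
  by move=> x Xx k _; have [_ XB _] := BP k; exact: XB.
have mB : measurable (\bigcap_k B k).
  by apply: bigcapT_measurable => k; have [] := BP k.
apply/eqP; rewrite eq_le; apply/andP; split; last first.
  rewrite -(measurable_mu_extE mu)//; apply: le_mu_ext => x Xx k _.
  by have [_ XB _] := BP k; exact: XB.
apply/lee_addgt0Pr => e e0.
near \oo => k.
have [mBk XB Bk] := BP k.
apply: (@le_trans _ _ (mu (B k))).
  by apply: le_measure; rewrite ?inE//; exact: bigcap_inf.
apply: (le_trans Bk); rewrite leeD2l// lee_fin ltW//.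
near: k; exact: near_infty_natSinv_lt (PosNum e0).
Unshelve. all: by end_near. Qed.

Hypothesis sf : sigma_finite setT mu.

(** Sigma-finiteness reduces to sets of finite measure, where the excess of a
    measurable hull over the set is a set of outer measure zero and so has a
    null hull. Passing to complements turns hulls from outside into kernels
    from inside. *)
Lemma caratheodory_sandwich (E : set (caratheodory_type (mu^*)%mu)) :
  measurable E ->
  exists B N : set T, [/\ measurable B, measurable N, mu N = 0, B `<=` E &
    E `<=` B `|` N].
Proof.
suff outer (F : set (caratheodory_type (mu^*)%mu)) : measurable F ->
    exists B N : set T, [/\ measurable B, measurable N, mu N = 0, F `<=` B &
      B `\` F `<=` N].
  move=> mE; have [B [N [mB mN N0 EB BE]]] := outer _ (measurableC mE).
  exists (~` B), N; split => //; first exact: measurableC.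
    by move=> x nBx; apply: contrapT => Ex; exact/nBx/EB.
  move=> x Ex; have [Bx|] := pselect (B x); last by left.
  by right; apply: BE; split=> // nEx.
move=> mF.
have /sigma_finiteP[S [TS ndS Soo]] := sf.
pose cmu : {measure set (caratheodory_type (mu^*)%mu) -> \bar R} :=
  @completed_measure_extension _ _ _ mu.
have cmuE A : cmu A = (mu^*)%mu A by [].
have carS A : measurable (A : set T) ->
    measurable (A : set (caratheodory_type (mu^*)%mu)).
  by move=> mA; apply: sub_caratheodory; exact: sub_sigma_algebra.
have pieces i : exists BN : set T * set T, [/\ measurable BN.1,
    measurable BN.2, mu BN.2 = 0, F `&` S i `<=` BN.1 &
    BN.1 `\` (F `&` S i) `<=` BN.2].
  have [B [mB FB] BE] := mu_ext_hull (F `&` S i).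
  have mFS : measurable (F `&` S i : set (caratheodory_type (mu^*)%mu)).
    by apply: measurableI => //; apply: carS; exact: (Soo i).1.
  have FSoo : cmu (F `&` S i) < +oo.
    apply: (@le_lt_trans _ _ (mu (S i))); last exact: (Soo i).2.
    rewrite -(measurable_mu_extE mu); last exact: (Soo i).1.
    exact: (@le_mu_ext _ _ _ mu _ _ (@subIsetr _ F (S i))).
  have [N [mN BN] NE] := mu_ext_hull (B `\` (F `&` S i)).
  exists (B, N); split => //=; rewrite NE -cmuE measureD//=; last 2 first.
  - exact: carS.
  - by rewrite /completed_measure_extension measurable_mu_extE// BE.
  rewrite setIidr// /completed_measure_extension measurable_mu_extE// BE.
  by rewrite subee// ge0_fin_numE// mu_ext_ge0.
have [BN BNP] := choice pieces.
exists (\bigcup_i (BN i).1), (\bigcup_i (BN i).2); split.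
- by apply: bigcupT_measurable => i; have [] := BNP i.
- by apply: bigcupT_measurable => i; have [] := BNP i.
- apply: (@measure_negligible _ _ _ mu).
    by apply: bigcupT_measurable => i; have [] := BNP i.
  apply: negligible_bigcup => i; have [_ mN N0 _ _] := BNP i.
  by exists (BN i).2; split.
- move=> x Fx; have [i _ Si] : (\bigcup_i S i) x by rewrite -TS.
  by exists i => //; have [_ _ _ FB _] := BNP i; apply: FB.
- move=> x [[i _ Bx] nFx]; exists i => //; have [_ _ _ _] := BNP i; apply.
  by split => // -[].
Qed.

End hull.

Section almost_everywhere_monotone.
Context d (T : measurableType d) (R : realType) (mu : {measure set T -> \bar R}).

Lemma ae_mono (P Q : T -> Prop) : (forall x, P x -> Q x) ->
  {ae mu, forall x, P x} -> {ae mu, forall x, Q x}.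
Proof. by move=> PQ; apply: filterS. Qed.

Lemma ae_mono2 (P Q S : T -> Prop) : (forall x, P x -> Q x -> S x) ->
  {ae mu, forall x, P x} -> {ae mu, forall x, Q x} -> {ae mu, forall x, S x}.
Proof. by move=> PQS; apply: filterS2. Qed.

End almost_everywhere_monotone.

Section completion.
Context d d' (T : measurableType d) (T' : measurableType d') (R : realType).

(** A set with two sigma-algebras, one completing the other, is encoded as two
    measurable types T and T' related by mutually inverse maps i and j; both
    maps are the identity of the common carrier in the two cases used here, the
    line and the space of dimension n. *)
Record completion_of (m : {measure set T -> \bar R})
    (m' : {measure set T' -> \bar R}) (i : T' -> T) (j : T -> T') : Prop := {
  compl_cancelij : cancel i j ;
  compl_cancelji : cancel j i ;
  compl_measurable : measurable_fun setT i ;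
  compl_measure : forall A, measurable A -> m' (i @^-1` A) = m A ;
  compl_sandwich : forall E : set T', measurable E ->
    exists B N : set T, [/\ measurable B, measurable N, m N = 0%E,
      i @^-1` B `<=` E & E `<=` i @^-1` (B `|` N)] ;
  compl_complete : measure_is_complete m' }.

Variables (m : {measure set T -> \bar R}) (m' : {measure set T' -> \bar R})
  (i : T' -> T) (j : T -> T').
Hypothesis H : completion_of m m' i j.

Let mpre (A : set T) : measurable A -> measurable (i @^-1` A).
Proof.
move=> mA; rewrite -[X in measurable X]setTI.
exact: compl_measurable H _ _ mA.
Qed.

Lemma ge0_integral_completion (f : T -> \bar R) : measurable_fun setT f ->
  (forall x, 0 <= f x)%E -> (\int[m']_x f (i x) = \int[m]_x f x)%E.
Proof.
move=> mf f0.
pose im : {mfun T' >-> T} :=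
  HB.pack i (isMeasurableFun.Build _ _ _ _ i (compl_measurable H)).
transitivity (\int[pushforward m' im]_x f x)%E; last first.
  by apply: eq_measure_integral => A mA _; exact: (compl_measure H mA).
by rewrite (ge0_integral_pushforward (compl_measurable H))//.
Qed.

Lemma integral_completion (f : T -> \bar R) : measurable_fun setT f ->
  (\int[m']_x f (i x) = \int[m]_x f x)%E.
Proof.
move=> mf; rewrite integralE [in RHS]integralE.
rewrite -(ge0_integral_completion (measurable_funepos mf)); last first.
  by move=> x; exact: funepos_ge0.
rewrite -(ge0_integral_completion (measurable_funeneg mf)); last first.
  by move=> x; exact: funeneg_ge0.
by congr (_ - _)%E; apply: eq_integral => x _; rewrite ?funeposE ?funenegE.
Qed.

Lemma ae_completion (P : T -> Prop) : {ae m, forall x, P x} ->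
  {ae m', forall x, P (i x)}.
Proof.
move=> [A [mA A0 PA]]; exists (i @^-1` A); split; first exact: mpre.
  by rewrite (compl_measure H).
by move=> x /= nP; exact: PA.
Qed.

(** The inner Borel set of a sandwiched null set is null as well, so that every
    null set of the completion lies in a Borel null set. *)
Lemma completion_ae (P : T' -> Prop) : {ae m', forall x, P x} ->
  {ae m, forall x, P (j x)}.
Proof.
move=> [A [mA A0 PA]].
have [B [N [mB mN N0 BA AB]]] := compl_sandwich H mA.
exists (B `|` N); split; first exact: measurableU.
  have : (m (B `|` N) <= m B + m N)%E by exact: measureU2.
  move=> mBN; apply/eqP; rewrite -measure_le0; apply: (le_trans mBN).
  rewrite N0 adde0 -(compl_measure H)// -A0; apply: le_measure; rewrite ?inE//.
  exact: mpre.
by move=> x /= nP; have := AB _ (PA _ nP); rewrite /= (compl_cancelji H).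
Qed.

(** Each set q < f with q rational is Borel up to a null set; f cut off to 0 on
    the countable union N of these null sets is Borel, since its rays are
    recovered from the rational ones. *)
Lemma borel_representative (f : T' -> R) : measurable_fun setT f ->
  exists (N : set T) (f0 : T -> R), [/\ measurable N, m N = 0%E,
    measurable_fun setT f0 & forall x, ~ N (i x) -> f x = f0 (i x)].
Proof.
move=> mf.
have mE (q : rat) : measurable [set x | ratr q < f x].
  rewrite [X in measurable X](_ : _ = setT `&` f @^-1` `]ratr q, +oo[%classic).
    by apply: mf.
  by rewrite setTI; apply/seteqP; split => x /=; rewrite in_itv/= andbT.
have /choice[BN BNP] (q : rat) : exists BN : set T * set T, [/\ measurable BN.1,
    measurable BN.2, m BN.2 = 0%E, i @^-1` BN.1 `<=` [set x | ratr q < f x]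
  & [set x | ratr q < f x] `<=` i @^-1` (BN.1 `|` BN.2)].
  have [B [N P]] := compl_sandwich H (mE q); by exists (B, N).
pose N := \bigcup_q (BN q).2.
have mN : measurable N.
  by apply: bigcupT_measurable_rat => q; have [] := BNP q.
exists N, (fun y => f (j y) * \1_(~` N) y); split => //.
- apply: (@measure_negligible _ _ _ m) => //.
  have -> : N = \bigcup_k (if unpickle k is Some q then (BN q).2 else set0).
    apply/seteqP; split => [x [q _ Nq]|x [k _]].
      by exists (pickle q); [|rewrite pickleK].
    by case: unpickle => // q Nq; exists q.
  apply: negligible_bigcup => k.
  case: unpickle => [q|]; last exact: negligible_set0.
  by have [_ mNq Nq0 _ _] := BNP q; exists (BN q).2; split.
- apply: (measurability _ (RGenOInfty.measurableE R)) => _ [_ [a ->] <-].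
  rewrite setTI [X in measurable X](_ : _ =
      (\bigcup_(q : rat) (if a < ratr q then (BN q).1 else set0)) `&` ~` N `|`
      (if a < 0 then N else set0)).
    apply: measurableU; last by case: ifP.
    apply: measurableI; last exact: measurableC.
    by apply: bigcupT_measurable_rat => q; case: ifP => // _; have [] := BNP q.
  apply/seteqP; split => y /=; rewrite in_itv/= andbT indicE.
    have [Ny|nNy] := pselect (N y).
      rewrite memNset ?mulr0; last by move=> /(_ Ny).
      by move=> ->; right.
    rewrite mem_set// mulr1 => af; left; split => //.
    have [q aq] := rat_in_itvoo af; move: aq; rewrite in_itv/= => /andP[aq qf].
    exists q => //; rewrite aq.
    have [_ _ _ _ /(_ _ qf)] := BNP q; rewrite /= (compl_cancelji H) => -[//|Nq].
    by exfalso; apply: nNy; exists q.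
  case=> [[[q _ Bq] nNy]|].
    rewrite mem_set// mulr1; move: Bq; case: ifP => // aq Bq.
    apply: (lt_trans aq); have [_ _ _ + _] := BNP q; apply.
    by rewrite /= (compl_cancelji H).
  by case: ifP => // a0 Ny; rewrite memNset ?mulr0// => /(_ Ny).
- by move=> x Nx; rewrite indicE mem_set// mulr1 (compl_cancelij H).
Qed.

Lemma ae_measurable_funR (f g : T' -> R) : {ae m', forall x, f x = g x} ->
  measurable_fun setT f -> measurable_fun setT g.
Proof.
move=> fg /measurable_EFinP mf; apply/measurable_EFinP.
apply: (ae_measurable_fun (compl_complete H) _ mf).
by apply: filterS fg => x fgx _; rewrite /= fgx.
Qed.

Lemma completion_measurable (h : T' -> R) (h0 : T -> R) :
  measurable_fun setT h0 -> {ae m', forall x, h x = h0 (i x)} ->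
  measurable_fun setT h.
Proof.
move=> mh0 hh0; apply: (ae_measurable_funR _ (f := fun x => h0 (i x))).
  by apply: ae_mono hh0 => x ->.
exact: (measurableT_comp mh0 (compl_measurable H)).
Qed.

Lemma integral_representative (h : T' -> R) (h0 : T -> R) :
  measurable_fun setT h0 -> {ae m', forall x, h x = h0 (i x)} ->
  (\int[m']_x (h x)%:E = \int[m]_x (h0 x)%:E)%E.
Proof.
move=> mh0 hh0; rewrite -(integral_completion (f := fun x => (h0 x)%:E)).
  apply: ae_eq_integral => //.
  - exact/measurable_EFinP/(completion_measurable mh0 hh0).
  - apply/measurable_EFinP.
    exact: (measurableT_comp mh0 (compl_measurable H)).
  - by apply: ae_mono hh0 => x /= -> _.
exact/measurable_EFinP.
Qed.

Lemma ae_representative (f : T' -> R) : measurable_fun setT f ->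
  exists2 f0 : T -> R, measurable_fun setT f0 &
    {ae m', forall x, f x = f0 (i x)}.
Proof.
move=> /borel_representative[N [f0 [mN N0 mf0 ff0]]]; exists f0 => //.
exists (i @^-1` N); split.
- exact: mpre.
- by rewrite (compl_measure H).
- by move=> x /= nff0; apply: contrapT => /ff0.
Qed.

End completion.

Section instances.
Context {R : realType}.

Lemma completion_lebesgueRn n : completion_of (borel_lebesgue n)
  (@lebesgueRn R n) (fun x => x) (fun x => x).
Proof.
have mm (A : set (borelRn R n)) : measurable A -> measurable (A : set (Rn R n)).
  by move=> mA; apply: sub_caratheodory; exact: sub_sigma_algebra.
split; [exact: frefl|exact: frefl|move=> _ A mA; rewrite setTI|move=> A mA|
  move=> E mE|].
- exact: mm.
- exact: (measurable_mu_extE (borel_lebesgue n)).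
- exact: (caratheodory_sandwich (sigma_finiteT (borel_lebesgue n)) mE).
- exact: measure_is_complete_caratheodory.
Qed.

Lemma completion_leb1 : completion_of (@lebesgue_measure R) leb1
  (fun x => x) (fun x => x).
Proof.
split; [exact: frefl|exact: frefl|move=> _ A mA; rewrite setTI|move=> A mA|
  move=> E mE|].
- exact: sub_caratheodory.
- by [].
- move: mE; rewrite -[measurable E]/((_.-cara).-measurable E).
  rewrite -completed_caratheodory_measurable g_sigma_completed_algebra_genE.
  move=> [B mB [M [N [mN N0 MN]]] <-]; exists B, N; split.
  + exact: mB.
  + exact: mN.
  + exact: N0.
  + by move=> x Bx; left.
  + by move=> x [Bx|Mx]; [left|right; exact: MN].
- exact: completed_lebesgue_measure_is_complete.
Qed.

End instances.

Section line.
Context {R : realType}.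
Notation lam := (@lebesgue_measure R).

Lemma measurable_unit_itv : measurable (@unit_itv R).
Proof. by apply: sub_caratheodory; exact: measurable_itv. Qed.

(** Since [h0] vanishes off [0, 1], integrals over [0, 1] become integrals over
    the whole line, the form in which Tonelli is used. *)
Lemma unit_integral_representative (h : Rline R -> R)
    (h0 : measurableTypeR R -> R) : measurable_fun setT h0 ->
  (forall t, ~ unit_itv t -> h0 t = 0) ->
  {ae leb1, forall t, unit_itv t -> h t = h0 t} ->
  measurable_fun unit_itv h /\
  (\int[leb1]_(t in unit_itv) (h t)%:E = \int[lam]_t (h0 t)%:E)%E.
Proof.
move=> mh0 h00 hh0.
have E : {ae leb1, forall t, (h \_ unit_itv) t = h0 t}.
  apply: ae_mono hh0 => t; rewrite /patch; case: ifPn => [/set_mem tI /(_ tI)//|].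
  by move=> /negP tI _; rewrite h00// => /mem_set.
split.
  apply/(measurable_restrictT _ measurable_unit_itv).
  exact: (completion_measurable completion_leb1 mh0 E).
rewrite integral_mkcond restrict_EFin.
exact: (integral_representative completion_leb1 mh0 E).
Qed.

(** Borel versions of s and psi. The values of s on the null set where it
    vanishes are replaced by 1, to make every dilation by [s0 t] invertible. *)
Lemma line_representatives (s psi : Rline R -> R) :
  measurable_fun unit_itv s -> measurable_fun unit_itv psi ->
  (forall t, unit_itv t -> 0 <= psi t) ->
  {ae leb1, forall t, unit_itv t -> s t != 0} ->
  exists s0 psi0 : measurableTypeR R -> R,
    [/\ measurable_fun setT s0, measurable_fun setT psi0,
        (forall t, s0 t != 0), (forall t, 0 <= psi0 t) &
      (forall t, ~ unit_itv t -> psi0 t = 0) /\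
      {ae leb1, forall t, unit_itv t -> s t = s0 t /\ psi t = psi0 t}].
Proof.
move=> ms mpsi psi_ge0 s_neq0.
have mU := measurable_unit_itv.
have ms' := (measurable_restrictT s mU).1 ms.
have mpsi' := (measurable_restrictT psi mU).1 mpsi.
have [s1 ms1 ss1] := ae_representative completion_leb1 ms'.
have [p1 mp1 pp1] := ae_representative completion_leb1 mpsi'.
exists (fun t => if s1 t == 0 then 1 else s1 t),
  (fun t => Num.max (p1 t) 0 * \1_(`[0, 1]%classic) t); split.
- apply: measurable_fun_ifT => //; exact: measurable_fun_eqr.
- apply: measurable_funM; last exact: measurable_indic.
  exact: measurable_maxr.
- by move=> t; case: ifPn => //; rewrite oner_eq0.
- by move=> t; rewrite mulr_ge0// le_max lexx orbT.
split.
  by move=> t tI; rewrite indicE memNset ?mulr0.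
have sp1 : {ae leb1, forall t, (s \_ unit_itv) t = s1 t /\
    (psi \_ unit_itv) t = p1 t} by apply: ae_mono2 ss1 pp1 => t.
apply: ae_mono2 s_neq0 sp1 => t.
rewrite /patch => + [+ +] tI; rewrite mem_set// => /(_ tI) s0 <- <-.
rewrite (negbTE s0); split => //; rewrite indicE mem_set// mulr1.
by apply/esym/max_idPl; exact: psi_ge0.
Qed.

End line.

(** * Dilations and Lebesgue measure *)

Section scaling.
Context {R : realType}.
Notation lam := (@lebesgue_measure R).

Lemma measurable_mulT (a : R) :
  measurable_fun setT (fun x : measurableTypeR R => a * x : measurableTypeR R).
Proof. exact: mulrl_measurable. Qed.

(** By uniqueness of Lebesgue measure, it suffices to compare lengths of
    half-open intervals; the sign of a decides which end is closed after
    dilation. *)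
Lemma lebesgue_measure_mul (a : R) (A : set (measurableTypeR R)) : a != 0 ->
  measurable A ->
  lam [set x | A (a * x)] = ((`|a|^-1)%:E * lam A)%E.
Proof.
move=> a0 mA.
have na0 : 0 < `|a| by rewrite normr_gt0.
pose phi := fun x : measurableTypeR R => a * x : measurableTypeR R.
pose m :=
  mscale (NngNum (ltW na0)) (pushforward lam phi)
  : {measure set (measurableTypeR R) -> \bar R}.
suff /(_ _ mA) -> : forall A, measurable A -> lam A = m (measurable_mulT a) A.
  by rewrite /m /mscale/= muleA -EFinM mulVf ?gt_eqF// mul1e.
apply: lebesgue_measure_unique => X /ocitvP[->|[x xx ->]].
  by rewrite !measure0.
rewrite (_ : m _ _ =
  `|a|%:E * lam [set t | `]x.1, x.2]%classic (a * t)%R])%E//.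
have [agt0|ale0] := ltP 0 a.
  rewrite (_ : [set t | `]x.1, x.2]%classic (a * t)] =
      `]x.1 / a, x.2 / a]%classic); last first.
    apply/seteqP; split => t /=; rewrite !in_itv/= ltr_pdivrMr// ler_pdivlMr//;
    by rewrite (mulrC t a).
  rewrite !lebesgue_measure_itv/= !lte_fin ltr_pM2r ?invr_gt0//.
  case: ifPn => _; rewrite ?mule0//= -?EFinB -EFinM gtr0_norm//; congr EFin.
  by rewrite -mulrBl mulrCA divff ?mulr1// gt_eqF.
have alt0 : a < 0 by rewrite lt_neqAle a0.
rewrite (_ : [set t | `]x.1, x.2]%classic (a * t)] =
    `[x.2 / a, x.1 / a[%classic); last first.
  apply/seteqP; split => t /=; rewrite !in_itv/= ltr_ndivlMr// ler_ndivrMr//;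
  by rewrite (mulrC t a) andbC.
rewrite !lebesgue_measure_itv/= !lte_fin ltr_nM2r ?invr_lt0//.
case: ifPn => _; rewrite ?mule0//= -?EFinB -EFinM ltr0_norm//; congr EFin.
by rewrite -mulrBl mulrCA mulNr divff// mulrN1 opprB.
Qed.

Lemma tscale_tcons n (a : R) (z : measurableTypeR R * borelRn R n) :
  tscale a (tcons z) = tcons (a * z.1, tscale a z.2).
Proof.
apply: eq_from_tnth => i; rewrite tnth_mktuple /tcons.
have [j ->|->] := unliftP ord0 i.
  by rewrite !tnthS tnth_mktuple.
by rewrite !tnth0.
Qed.

Lemma measurable_tscale n (a : R) :
  measurable_fun setT (@tscale R n a : borelRn R n -> borelRn R n).
Proof.
apply/measurable_fun_tnthP => i.
rewrite (_ : _ \o _ = fun x : borelRn R n => a * tnth x i).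
  by apply: measurable_funM => //; exact: measurable_tnth.
by apply/funext => x; rewrite /= tnth_mktuple.
Qed.

Lemma measurable_tscale_set n (a : R) (A : set (borelRn R n)) : measurable A ->
  measurable ([set x | A (tscale a x)] : set (borelRn R n)).
Proof.
by move=> mA; rewrite -[X in measurable X]setTI; exact: measurable_tscale.
Qed.

Lemma ge0_integral_lebesgue_mul (a : R) (f : measurableTypeR R -> \bar R) :
  a != 0 -> measurable_fun setT f -> (forall x, 0 <= f x)%E ->
  (\int[lam]_x f (a * x)%R = (`|a|^-1)%:E * \int[lam]_x f x)%E.
Proof.
move=> a0 mf f0.
pose phi : {mfun measurableTypeR R >-> measurableTypeR R} :=
  HB.pack (fun x : measurableTypeR R => a * x : measurableTypeR R)
    (isMeasurableFun.Build _ _ _ _ _ (measurable_mulT a)).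
have na0 : 0 <= `|a|^-1 by rewrite invr_ge0.
transitivity (\int[pushforward lam phi]_x f x)%E.
  by rewrite (ge0_integral_pushforward (measurable_mulT a)).
transitivity (\int[mscale (NngNum na0) lam]_x f x)%E.
  apply: eq_measure_integral => A mA _.
  exact: (lebesgue_measure_mul a0 mA).
by rewrite ge0_integral_mscale.
Qed.

(** Induction on the dimension: the section at u of a dilated set is the
    dilated section at a u, so one factor 1/|a| comes from the new coordinate
    and the others from the induction hypothesis. *)
Lemma borel_lebesgue_tscale n (a : R) (A : set (borelRn R n)) : a != 0 ->
  measurable A ->
  borel_lebesgue n [set x | A (tscale a x)] =
  ((`|a|^-n)%:E * borel_lebesgue n A)%E.
Proof.
move=> a0; elim: n A => [|n IH] A mA.
  rewrite expr0 invr1 mul1e; congr (borel_lebesgue 0 _).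
  by apply/seteqP; split => x /=; rewrite [tscale a x]tuple0 [x]tuple0.
rewrite /= /lebesgue_step /pushforward.
have mpre (B : set (borelRn R n.+1)) : measurable B ->
    measurable (@tcons R n @^-1` B).
  by move=> mB; rewrite -[X in measurable X]setTI; exact: measurable_tcons.
rewrite /product_measure1.
transitivity (\int[lam]_x ((`|a|^-n)%:E *
    borel_lebesgue n (xsection (@tcons R n @^-1` A) (a * x)%R)))%E.
  apply: eq_integral => x _.
  rewrite /= -IH; last by apply: measurable_xsection; exact: mpre.
  congr (borel_lebesgue n _); apply/seteqP; split => y; rewrite /xsection/=;
    by rewrite !inE /= tscale_tcons.
have mF : measurable_fun setT
    (fun x => borel_lebesgue n (xsection (@tcons R n @^-1` A) x)).
  exact: (measurable_fun_xsection (borel_lebesgue n) (mpre _ mA)).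
have an0 : 0 <= `|a| ^- n by rewrite invr_ge0 exprn_ge0.
rewrite ge0_integralZl//; last first.
  by apply: (measurableT_comp mF); exact: measurable_mulT.
rewrite (ge0_integral_lebesgue_mul a0 mF)//.
by rewrite muleA -EFinM -invfM -exprSr.
Qed.

Lemma ge0_integral_tscale n (a : R) (f : borelRn R n -> \bar R) :
  a != 0 -> measurable_fun setT f -> (forall x, 0 <= f x)%E ->
  (\int[borel_lebesgue n]_x f (tscale a x) =
   (`|a|^-n)%:E * \int[borel_lebesgue n]_x f x)%E.
Proof.
move=> a0 mf f0.
pose phi : {mfun borelRn R n >-> borelRn R n} :=
  HB.pack (@tscale R n a : borelRn R n -> borelRn R n)
    (isMeasurableFun.Build _ _ _ _ _ (measurable_tscale (n := n) a)).
have na0 : 0 <= `|a|^-n by rewrite invr_ge0 exprn_ge0.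
transitivity (\int[pushforward (borel_lebesgue n) phi]_x f x)%E.
  by rewrite (ge0_integral_pushforward (measurable_tscale (n := n) a)).
transitivity (\int[mscale (NngNum na0) (borel_lebesgue n)]_x f x)%E.
  apply: eq_measure_integral => A mA _.
  exact: (borel_lebesgue_tscale a0 mA).
by rewrite ge0_integral_mscale.
Qed.

End scaling.

Section volume.
Context {R : realType}.
Notation lam := (@lebesgue_measure R).

Definition cube n (rho : R) : set (borelRn R n) :=
  [set x | forall i, `|tnth x i| <= rho].
Arguments cube : clear implicits.

Lemma measurable_cube n rho : measurable (cube n rho).
Proof.
rewrite (_ : cube n rho = \bigcap_(i in [set: 'I_n])
    ((fun x : borelRn R n => tnth x i) @^-1` `[- rho, rho]%classic)).
  apply: fin_bigcap_measurable => // i _.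
  by rewrite -[X in measurable X]setTI; apply: measurable_tnth.
apply/seteqP; split => x /= H i; first by rewrite /= in_itv/= -ler_norml.
by have := H i Logic.I; rewrite /= in_itv/= -ler_norml.
Qed.

(** Only finiteness and positivity of such volumes matter below, as a way to
    control balls. *)
Lemma borel_lebesgue_cube n (rho : R) : 0 <= rho ->
  borel_lebesgue n (cube n rho) = ((2 * rho) ^+ n)%:E.
Proof.
move=> rho0; elim: n => [|n IH].
  rewrite expr0 /= diracE mem_set//; first by case.
have -> : borel_lebesgue n.+1 (cube n.+1 rho) =
    (lam \x borel_lebesgue n)%E (`[- rho, rho]%classic `*` cube n rho).
  rewrite [LHS]/(lebesgue_step _ _) /lebesgue_step /pushforward; congr (_ _).
  apply/seteqP; split => -[u v] /=.
    move=> H; split; first by have := H ord0; rewrite tnth0 in_itv/= -ler_norml.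
    by move=> i; have := H (lift ord0 i); rewrite tnthS.
  rewrite in_itv/= -ler_norml => -[ur vr] i.
  by have [j ->|->] := unliftP ord0 i; rewrite ?tnthS ?tnth0//; exact: vr.
rewrite product_measure1E//; last exact: measurable_cube.
have L : lam (`[- rho, rho]%classic : set R) = (2 * rho)%:E.
  rewrite lebesgue_measure_itv/= lte_fin; case: ifPn => [_|].
    by rewrite -EFinB; congr EFin; ring.
  by rewrite -leNgt => rho_le; congr EFin; lra.
rewrite IH; apply: etrans (congr1 (fun z => z * _)%E L) _.
by rewrite -EFinM exprS.
Qed.

Lemma borel_lebesgue_setT_gt0 n : (0 < borel_lebesgue n setT :> \bar R)%E.
Proof.
apply: (@lt_le_trans _ _ (borel_lebesgue n (cube n 1))).
  by rewrite borel_lebesgue_cube// lte_fin exprn_gt0// mulr_gt0.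
by apply: le_measure; rewrite ?inE//; exact: measurable_cube.
Qed.

Lemma lebesgueRn_setT_gt0 n : (0 < @lebesgueRn R n setT)%E.
Proof.
have := compl_measure (completion_lebesgueRn n) (@measurableT _ (borelRn R n)).
by rewrite preimage_setT => ->; exact: borel_lebesgue_setT_gt0.
Qed.

Lemma ae_tscale n (a : R) (P : borelRn R n -> Prop) : a != 0 ->
  {ae borel_lebesgue n, forall x, P x} ->
  {ae borel_lebesgue n, forall x, P (tscale a x)}.
Proof.
move=> a0 [A [mA A0 PA]]; exists [set x | A (tscale a x)]; split.
- exact: measurable_tscale_set.
- by rewrite borel_lebesgue_tscale// A0 mule0.
- by move=> x nP; apply: PA.
Qed.

End volume.
Arguments cube {R} n rho.

(** Homogeneity holds for the weight itself at every point, but survives only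
    almost everywhere for a Borel version, for each dilation factor apart. *)
Lemma weight_representative (R : realType) n alpha (w : n.-tuple R -> R) :
  homogeneous_weight alpha w -> exists w0 : borelRn R n -> R,
  [/\ measurable_fun setT w0, (forall x, 0 <= w0 x),
     {ae lebesgueRn n, forall x, w x = w0 x /\ 0 < w0 x} &
     forall a : R, a != 0 ->
       {ae borel_lebesgue n, forall x, w0 (tscale a x) = `|a| `^ alpha * w0 x}].
Proof.
move=> [mw w_gt0 _ hom].
have [w1 mw1 ww1] := ae_representative (completion_lebesgueRn n) mw.
have ww0 : {ae lebesgueRn n, forall x,
    w x = Num.max (w1 x) 0 /\ 0 < Num.max (w1 x) 0}.
  apply: ae_mono2 w_gt0 ww1 => x wx E; rewrite -E; split => //.
    by apply/esym/max_idPl; exact: ltW.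
  by rewrite lt_max wx.
exists (fun x => Num.max (w1 x) 0); split => //.
- exact: measurable_maxr.
- by move=> x; rewrite le_max lexx orbT.
move=> a a0; have E := completion_ae (completion_lebesgueRn n) ww0.
apply: ae_mono2 E (ae_tscale a0 E) => x [<- _] [<- _]; exact: hom.
Qed.

(** * The averaging inequality for Borel functions *)

Section power_mean.
Context d (T : measurableType d) (R : realType) (mu : {measure set T -> \bar R}).
Local Open Scope ereal_scope.

Let eqW (x y : \bar R) : x = y -> x <= y.
Proof. by move=> ->. Qed.

(** Jensen's inequality for the power r and the measure of density k, without
    normalising k. It is Hoelder's inequality for the factors h k^(1/r) and
    k^(1/q), where q is the conjugate exponent; the case r = 1, where q is
    infinite, is an equality. *)
Lemma integral_powR_le (r : R) (h k : T -> R) : (1 <= r)%R ->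
  measurable_fun setT h -> measurable_fun setT k ->
  (forall x, 0 <= h x)%R -> (forall x, 0 <= k x)%R ->
  (\int[mu]_x (h x * k x)%:E) `^ r <=
  (\int[mu]_x (k x)%:E) `^ (r - 1) * \int[mu]_x (h x `^ r * k x)%:E.
Proof.
rewrite le_eqVlt => /orP[/eqP <-|r1] mh mk h0 k0.
  rewrite subrr poweRe0 mul1e poweRe1; last first.
    by apply: integral_ge0 => x _; rewrite lee_fin mulr_ge0.
  by apply: eqW; apply: eq_integral => x _; rewrite powRr1.
have r0 : (0 < r)%R by exact: lt_trans r1.
have r10 : (0 < r - 1)%R by rewrite subr_gt0.
set q := (r / (r - 1))%R.
have q0 : (0 < q)%R by rewrite divr_gt0.
have rq : (r^-1 + q^-1 = 1)%R by rewrite /q; field; rewrite !gt_eqF.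
have mkr (s : R) : measurable_fun setT (fun x => k x `^ s)%R.
  exact: (measurableT_comp (measurable_powR s) mk).
pose f1 x := (h x * k x `^ r^-1)%R.
pose f2 x := (k x `^ q^-1)%R.
have mf1 : measurable_fun setT f1 by exact: measurable_funM.
have := hoelder mu mf1 (mkr _ : measurable_fun setT f2) r0 q0 rq.
rewrite Lnorm1 unlock => H.
have kE x : (k x `^ r^-1 * k x `^ q^-1 = k x)%R.
  by rewrite -powRD rq ?powRr1// oner_eq0.
have {}H : \int[mu]_x (h x * k x)%:E <=
    (\int[mu]_x (h x `^ r * k x)%:E) `^ r^-1 * (\int[mu]_x (k x)%:E) `^ q^-1.
  apply: le_trans (le_trans H _).
    apply: eqW; apply: eq_integral => x _ /=.
    by rewrite ger0_norm /f1 /f2 ?mulr_ge0 ?powR_ge0// -mulrA kE.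
  apply: eqW; congr (_ `^ _ * _ `^ _); apply: eq_integral => x _ /=.
    rewrite ger0_norm /f1 ?mulr_ge0 ?powR_ge0// powRM ?powR_ge0//.
    by rewrite -powRrM mulVf ?gt_eqF// powRr1.
  rewrite ger0_norm /f2 ?powR_ge0//.
  by rewrite -powRrM mulVf ?gt_eqF// powRr1.
have I0 : 0 <= \int[mu]_x (k x)%:E.
  by apply: integral_ge0 => x _; rewrite lee_fin.
have J0 : 0 <= \int[mu]_x (h x `^ r * k x)%:E.
  by apply: integral_ge0 => x _; rewrite lee_fin mulr_ge0 ?powR_ge0.
apply: (@le_trans _ _ (((\int[mu]_x (h x `^ r * k x)%:E) `^ r^-1 *
    (\int[mu]_x (k x)%:E) `^ q^-1) `^ r)).
  apply: gt0_ler_poweR => //; rewrite ?ltW// in_itv/= leey andbT.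
    by apply: integral_ge0 => x _; rewrite lee_fin mulr_ge0.
  by rewrite mule_ge0 ?poweR_ge0.
rewrite poweRM ?poweR_ge0// -!poweRrM mulVf ?gt_eqF// poweRe1// muleC.
rewrite (_ : (q^-1 * r = r - 1)%R)//.
by rewrite /q; field; rewrite !gt_eqF.
Qed.

End power_mean.

Section averaging.
Context {R : realType} (n : nat).
Notation lam := (@lebesgue_measure R).
Notation mu := (@borel_lebesgue R n).
Variables (alpha r : R) (r1 : 1 <= r).
Let gamma := (n%:R + alpha) / r.
Variable w0 : borelRn R n -> R.
Hypotheses (mw0 : measurable_fun setT w0) (w0_ge0 : forall x, 0 <= w0 x).
Hypothesis w0_hom : forall a : R, a != 0 ->
  {ae mu, forall x, w0 (tscale a x) = `|a| `^ alpha * w0 x}.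
Variable g : borelRn R n -> R.
Hypotheses (mg : measurable_fun setT g) (g_ge0 : forall x, 0 <= g x).
Local Open Scope ereal_scope.

(** The factor is |a|^-(n + alpha): n from Lebesgue measure and alpha from the
    weight. *)
Lemma weighted_scaling (a : R) : (a != 0)%R ->
  \int[mu]_x (g (tscale a x) `^ r * w0 x)%:E =
  (`|a| `^ (- gamma * r))%:E * \int[mu]_x (g x `^ r * w0 x)%:E.
Proof.
move=> a0.
have na0 : (0 < `|a|)%R by rewrite normr_gt0.
have mgw : measurable_fun setT (fun x => g x `^ r * w0 x)%R.
  apply: measurable_funM => //.
  exact: (measurableT_comp (measurable_powR r) mg).
have mgwa : measurable_fun setT
    (fun x => g (tscale a x) `^ r * w0 (tscale a x))%R.
  exact: (measurableT_comp mgw (measurable_tscale (n := n) a)).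
transitivity (\int[mu]_x ((`|a| `^ (- alpha))%:E *
    (g (tscale a x) `^ r * w0 (tscale a x))%:E)).
  apply: ae_eq_integral => //.
  - apply/measurable_EFinP; apply: measurable_funM => //.
    apply: (measurableT_comp (measurable_powR r)).
    exact: (measurableT_comp mg (measurable_tscale (n := n) a)).
  - by apply/measurable_EFinP; apply: measurable_funM.
  apply: ae_mono (w0_hom a0) => x /= E _; rewrite E -EFinM; congr EFin.
  rewrite powRN; set A := (`|a| `^ alpha)%R.
  have A0 : A != 0%R by rewrite gt_eqF ?powR_gt0.
  by field.
rewrite ge0_integralZl//; last 2 first.
- exact/measurable_EFinP.
- by move=> x _; rewrite lee_fin mulr_ge0 ?powR_ge0.
rewrite (@ge0_integral_tscale R n a (fun x => (g x `^ r * w0 x)%:E))//;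
  last 2 first.
- exact/measurable_EFinP.
- by move=> x; rewrite lee_fin mulr_ge0 ?powR_ge0.
rewrite muleA -EFinM -powR_invn// -powRD; last by rewrite normr_eq0 a0 implybT.
congr ((_ `^ _)%:E * _); rewrite /gamma; field.
by rewrite gt_eqF// (lt_le_trans ltr01).
Qed.

Variables s0 psi0 : measurableTypeR R -> R.
Hypotheses (ms0 : measurable_fun setT s0) (s0_neq0 : forall t, s0 t != 0%R).
Hypotheses (mpsi0 : measurable_fun setT psi0).
Hypothesis psi0_ge0 : forall t, (0 <= psi0 t)%R.

Lemma measurable_tscale2 : measurable_fun setT
  (fun z : measurableTypeR R * borelRn R n => tscale (s0 z.1) z.2 : borelRn R n).
Proof.
apply/measurable_fun_tnthP => i.
rewrite (_ : _ \o _ = fun z : measurableTypeR R * borelRn R n =>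
    (s0 z.1 * tnth z.2 i)%R); last first.
  by apply/funext => z; rewrite /= tnth_mktuple.
apply: measurable_funM; first exact: (measurableT_comp ms0 measurable_fst).
by apply: (measurableT_comp (f := fun x : borelRn R n => tnth x i));
  [exact: measurable_tnth|exact: measurable_snd].
Qed.

Let K := \int[lam]_t (`|s0 t| `^ (- gamma) * psi0 t)%:E.

(** Apply the power mean inequality in t for the measure |s0|^-gamma psi0 dt to
    the function g(s0(t) x) |s0(t)|^gamma, then integrate in x. By Tonelli and
    [weighted_scaling] the powers of |s0| cancel, leaving K^(r-1) K. *)
Lemma averaging_bound : K < +oo ->
  \int[mu]_x ((\int[lam]_t (g (tscale (s0 t) x) * psi0 t)%:E) `^ r * (w0 x)%:E) <=
  K `^ r * \int[mu]_x (g x `^ r * w0 x)%:E.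
Proof.
move=> Koo.
have r0 : (0 < r)%R by exact: lt_le_trans r1.
have ns0 t : (0 < `|s0 t|)%R by rewrite normr_gt0.
have K0 : 0 <= K.
  by apply: integral_ge0 => t _; rewrite lee_fin mulr_ge0 ?powR_ge0.
have mns (e : R) : measurable_fun setT (fun t => `|s0 t| `^ e)%R.
  apply: (measurableT_comp (measurable_powR e)).
  exact: (measurableT_comp (@normr_measurable R setT) ms0).
have mk : measurable_fun setT (fun t => `|s0 t| `^ (- gamma) * psi0 t)%R.
  exact: measurable_funM.
have mgs : measurable_fun setT (fun z : measurableTypeR R * borelRn R n =>
    g (tscale (s0 z.1) z.2)).
  exact: (measurableT_comp mg measurable_tscale2).
have mgsx x : measurable_fun setT (fun t => g (tscale (s0 t) x)).
  exact: (measurableT_comp mgs (measurable_pair2 x)).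
have msy (f : measurableTypeR R -> R) : measurable_fun setT f ->
    measurable_fun setT (fun z : measurableTypeR R * borelRn R n => f z.1).
  by move=> mf; exact: (measurableT_comp mf measurable_fst).
(* [F] is the joint integrand left by the power mean inequality applied to
   g(s(t)x)|s(t)|^gamma and the density of the measure of total mass K. *)
pose F (z : measurableTypeR R * borelRn R n) : \bar R :=
  ((g (tscale (s0 z.1) z.2) * `|s0 z.1| `^ gamma) `^ r *
   (`|s0 z.1| `^ (- gamma) * psi0 z.1) * w0 z.2)%:E.
have mF : measurable_fun setT F.
  apply/measurable_EFinP; apply: measurable_funM; last first.
    exact: (measurableT_comp mw0 measurable_snd).
  apply: measurable_funM; last exact: (msy _ mk).
  apply: (measurableT_comp (measurable_powR r)).
  by apply: measurable_funM => //; exact: (msy _ (mns gamma)).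
have F0 z : 0 <= F z by rewrite lee_fin !mulr_ge0 ?powR_ge0.
have step x : (\int[lam]_t (g (tscale (s0 t) x) * psi0 t)%:E) `^ r * (w0 x)%:E <=
    K `^ (r - 1) * \int[lam]_t F (t, x).
  have -> : \int[lam]_t F (t, x) = (\int[lam]_t
     ((g (tscale (s0 t) x) * `|s0 t| `^ gamma) `^ r *
      (`|s0 t| `^ (- gamma) * psi0 t))%:E) * (w0 x)%:E.
    rewrite -ge0_integralZr//.
    - apply/measurable_EFinP; apply: measurable_funM => //.
      apply: (measurableT_comp (measurable_powR r)).
      exact: measurable_funM.
    - by move=> t _; rewrite lee_fin !mulr_ge0 ?powR_ge0.
    - by rewrite lee_fin.
  rewrite muleA; apply: lee_wpmul2r; first by rewrite lee_fin.
  have -> : \int[lam]_t (g (tscale (s0 t) x) * psi0 t)%:E = \int[lam]_t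
      ((g (tscale (s0 t) x) * `|s0 t| `^ gamma) *
       (`|s0 t| `^ (- gamma) * psi0 t))%:E.
    apply: eq_integral => t _; congr EFin; rewrite powRN.
    set A := (`|s0 t| `^ gamma)%R.
    have A0 : A != 0%R by rewrite gt_eqF ?powR_gt0.
    by field.
  apply: integral_powR_le => //.
  - exact: measurable_funM.
  - by move=> t; rewrite mulr_ge0 ?powR_ge0.
  - by move=> t; rewrite mulr_ge0 ?powR_ge0.
pose I := \int[mu]_x (g x `^ r * w0 x)%:E.
have I0 : 0 <= I.
  by apply: integral_ge0 => x _; rewrite lee_fin mulr_ge0 ?powR_ge0.
apply: (@le_trans _ _ (\int[mu]_x (K `^ (r - 1) * \int[lam]_t F (t, x)))).
  apply: ge0_le_integral => //.
  - by move=> x _; rewrite mule_ge0 ?poweR_ge0// lee_fin.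
  - apply: emeasurable_funM; last exact/measurable_EFinP.
    apply: (measurableT_comp (measurable_poweR r)).
    apply: (measurable_fun_fubini_tonelli_G (fun z : measurableTypeR R *
      borelRn R n => (g (tscale (s0 z.1) z.2) * psi0 z.1)%:E)).
    + apply/measurable_EFinP; apply: measurable_funM => //.
      exact: (msy _ mpsi0).
    + by move=> z; rewrite lee_fin mulr_ge0.
  - apply: emeasurable_funM => //.
    exact: (measurable_fun_fubini_tonelli_G F mF F0).
rewrite ge0_integralZl//; last 3 first.
- exact: (measurable_fun_fubini_tonelli_G F mF F0).
- by move=> x _; exact: integral_ge0.
- exact: poweR_ge0.
rewrite -(fubini_tonelli F)//.
have inner t : \int[mu]_x F (t, x) = (`|s0 t| `^ (- gamma) * psi0 t)%:E * I.
  transitivity ((`|s0 t| `^ (gamma * r) * (`|s0 t| `^ (- gamma) * psi0 t))%:E *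
      \int[mu]_x (g (tscale (s0 t) x) `^ r * w0 x)%:E).
    rewrite -ge0_integralZl//; last 3 first.
    - apply/measurable_EFinP; apply: measurable_funM => //.
      apply: (measurableT_comp (measurable_powR r)).
      exact: (measurableT_comp mg (measurable_tscale (n := n) _)).
    - by move=> x _; rewrite lee_fin mulr_ge0 ?powR_ge0.
    - by rewrite lee_fin !mulr_ge0 ?powR_ge0.
    apply: eq_integral => x _; rewrite -EFinM; congr EFin => /=.
    rewrite powRM ?powR_ge0// -powRrM; ring.
  rewrite weighted_scaling// muleA -EFinM; congr (_%:E * _).
  rewrite mulNr (powRN _ (gamma * r)); set A := (`|s0 t| `^ (gamma * r))%R.
  have A0 : A != 0%R by rewrite gt_eqF ?powR_gt0.
  by field.
under eq_integral do rewrite inner.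
rewrite ge0_integralZr//; last 2 first.
- exact/measurable_EFinP.
- by move=> t _; rewrite lee_fin mulr_ge0 ?powR_ge0.
rewrite muleA -/K -/I.
have Kfin : K \is a fin_num by rewrite ge0_fin_numE.
rewrite -(fineK Kfin) !poweR_EFin -EFinM mulrC mulr_powRB1//.
exact: fine_ge0.
Qed.

End averaging.

(** * Complex-valued integrals *)

Section complex_integral.
Context d (T : measurableType d) (R : realType) (mu : {measure set T -> \bar R}).
Variable D : set T.
Hypothesis mD : measurable D.

Lemma normc_sqrtE (z : R[i]) :
  normc z = Num.sqrt (complex.Re z ^+ 2 + complex.Im z ^+ 2).
Proof. by case: z. Qed.

Lemma normc_nneg (z : R[i]) : 0 <= normc z.
Proof. by rewrite normc_sqrtE sqrtr_ge0. Qed.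

Lemma normr_Re_le_normc (z : R[i]) : `|complex.Re z| <= normc z.
Proof.
by rewrite normc_sqrtE -sqrtr_sqr ler_wsqrtr// lerDl sqr_ge0.
Qed.

Lemma normr_Im_le_normc (z : R[i]) : `|complex.Im z| <= normc z.
Proof.
by rewrite normc_sqrtE -sqrtr_sqr ler_wsqrtr// lerDr sqr_ge0.
Qed.

Lemma normc_le_ReIm (z : R[i]) : normc z <= `|complex.Re z| + `|complex.Im z|.
Proof.
rewrite normc_sqrtE -[leRHS]ger0_norm ?addr_ge0// -sqrtr_sqr ler_wsqrtr//.
rewrite sqrrD !real_normK ?num_real// lerD2r lerDl mulrn_wge0// mulr_ge0//.
Qed.

Lemma measurable_normc (F : T -> R[i]) : cmeasurable_fun D F ->
  measurable_fun D (fun t => normc (F t) : measurableTypeR R).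
Proof.
move=> [mr mi]; under eq_fun do rewrite normc_sqrtE.
apply: (measurableT_comp (f := @Num.sqrt R : measurableTypeR R -> _)).
  by apply: continuous_measurable_fun; exact: sqrt_continuous.
by apply: measurable_funD; exact: measurable_funX.
Qed.

(** With a + ib the value of the integral and N its modulus, N^2 is the
    integral of a Re F + b Im F, which is at most N |F| pointwise by
    Cauchy-Schwarz. *)
Lemma normc_cintegral_le (F : T -> R[i]) : cintegrable mu D F ->
  ((normc (cintegral mu D F))%:E <= \int[mu]_(t in D) (normc (F t))%:E)%E.
Proof.
move=> [ir ii].
have mF : cmeasurable_fun D F.
  by split; apply/measurable_EFinP;
    [exact: measurable_int ir|exact: measurable_int ii].
have iN : mu.-integrable D (fun t => (normc (F t))%:E).
  apply: (le_integrable mD _ _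
    (integrableD mD (integrable_abse ir) (integrable_abse ii))).
    exact/measurable_EFinP/measurable_normc.
  move=> t _ /=; rewrite lee_fin ger0_norm ?normc_nneg//.
  by rewrite ger0_norm ?addr_ge0// normc_le_ReIm.
set a := Rintegral mu D (fun t => complex.Re (F t)).
set b := Rintegral mu D (fun t => complex.Im (F t)).
rewrite -[cintegral _ _ _]/(Complex a b); set N := normc _.
have NE : N ^+ 2 = a * a + b * b by rewrite /N/= sqr_sqrtr ?addr_ge0 ?sqr_ge0.
have [N0|N0] := eqVneq N 0.
  by rewrite N0; apply: integral_ge0 => t _; rewrite lee_fin normc_nneg.
have Npos : 0 < N by rewrite lt_neqAle eq_sym N0 normc_nneg.
have Ea : (a%:E = \int[mu]_(t in D) (complex.Re (F t))%:E)%E.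
  by rewrite fineK// integrable_fin_num.
have Eb : (b%:E = \int[mu]_(t in D) (complex.Im (F t))%:E)%E.
  by rewrite fineK// integrable_fin_num.
have : ((N ^+ 2)%:E <= N%:E * \int[mu]_(t in D) (normc (F t))%:E)%E.
  rewrite NE EFinD !EFinM.
  rewrite [X in (_ * X + _)%E]Ea [X in (_ + _ * X)%E]Eb.
  rewrite -!integralZl// -integralD//; [|exact: integrableZl|exact: integrableZl].
  apply: le_integral => //.
  - by apply: integrableD => //; exact: integrableZl.
  - exact: integrableZl.
  move=> t _; rewrite -!EFinM -EFinD lee_fin.
  rewrite /N normc_sqrtE [in leRHS]normc_sqrtE/= -sqrtrM ?addr_ge0 ?sqr_ge0//.
  apply: le_trans (ler_norm _) _; rewrite -sqrtr_sqr ler_wsqrtr//.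
  set u := complex.Re _; set v := complex.Im _.
  rewrite -subr_ge0 (_ : _ - _ = (a * v - b * u) ^+ 2) ?sqr_ge0//; ring.
rewrite expr2 EFinM lee_pmul2l//.
Qed.

End complex_integral.

(** * The operator computed on representatives *)

Section operator.
Context {R : realType} (n : nat).
Notation lam := (@lebesgue_measure R).
Notation mu := (@borel_lebesgue R n).
Variables (s0 psi0 : measurableTypeR R -> R).
Hypotheses (ms0 : measurable_fun setT s0) (s0_neq0 : forall t, s0 t != 0).
Hypotheses (mpsi0 : measurable_fun setT psi0) (psi0_ge0 : forall t, 0 <= psi0 t).

(** Every dilation preserves the null set Z, so the set of pairs (t, x) with
    s0(t) x in Z is null; by Tonelli so are almost all of its sections at fixed
    x. *)
Lemma ae_avoid (Z : set (borelRn R n)) : measurable Z -> mu Z = 0%E ->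
  {ae mu, forall x, {ae lam, forall t, ~ Z (tscale (s0 t) x)}}.
Proof.
move=> mZ Z0.
pose F (z : measurableTypeR R * borelRn R n) : \bar R :=
  (\1_Z (tscale (s0 z.1) z.2))%:E.
have mZ1 : measurable_fun setT (\1_Z : borelRn R n -> R).
  exact: measurable_indic.
have mF : measurable_fun setT F.
  apply/measurable_EFinP.
  exact: (measurableT_comp mZ1 (measurable_tscale2 ms0)).
have F0 z : (0 <= F z)%E by rewrite lee_fin.
have I0 : (\int[mu]_x \int[lam]_t F (t, x) = 0)%E.
  rewrite -(fubini_tonelli F)//; apply: integral0_eq => t _.
  rewrite /F/= (@ge0_integral_tscale R n (s0 t) (fun x => (\1_Z x)%:E))//.
    have -> : (\int[mu]_x (\1_Z x)%:E = 0)%E; last by rewrite mule0.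
    by rewrite integral_indic//; move: Z0; rewrite setIT.
  exact/measurable_EFinP.
have mG := measurable_fun_fubini_tonelli_G (m1 := lam) F mF F0.
(* A nonnegative function with integral zero vanishes almost everywhere; this
   is used first for the section masses and then for each section. *)
have [+ _] := ae_eq_integral_abs mu measurableT mG.
have G0 x : (0 <= \int[lam]_t F (t, x))%E by exact: integral_ge0.
under eq_integral => x _ do rewrite gee0_abs ?G0//.
move=> /(_ I0); apply: ae_mono => x /(_ Logic.I) /= Gx.
have mFx : measurable_fun setT (fun t => F (t, x)).
  exact: (measurableT_comp mF (measurable_pair2 x)).
have [+ _] := ae_eq_integral_abs lam measurableT mFx.
under eq_integral => t _ do rewrite gee0_abs ?F0//.
move=> /(_ Gx); apply: ae_mono => t /(_ Logic.I); rewrite /F/= indicE => + Zt.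
by rewrite mem_set// => -[] /eqP; rewrite oner_eq0.
Qed.

(** The operator on real functions, extended-valued so that it makes sense
    without integrability. *)
Definition avg (c : borelRn R n -> R) (x : borelRn R n) : \bar R :=
  (\int[lam]_t (c (tscale (s0 t) x) * psi0 t)%:E)%E.

Lemma measurable_dilate2 (c : borelRn R n -> R) : measurable_fun setT c ->
  measurable_fun setT (fun z : measurableTypeR R * borelRn R n =>
    c (tscale (s0 z.1) z.2) * psi0 z.1).
Proof.
move=> mc; apply: measurable_funM.
  exact: (measurableT_comp mc (measurable_tscale2 ms0)).
exact: (measurableT_comp mpsi0 measurable_fst).
Qed.

Lemma measurable_dilate (c : borelRn R n -> R) x : measurable_fun setT c ->
  measurable_fun setT (fun t => c (tscale (s0 t) x) * psi0 t).
Proof.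
move=> mc; exact: (measurableT_comp (measurable_dilate2 mc) (measurable_pair2 x)).
Qed.

Lemma measurable_avg (c : borelRn R n -> R) : measurable_fun setT c ->
  measurable_fun setT (avg c).
Proof.
move=> mc; pose F (z : measurableTypeR R * borelRn R n) :=
  (c (tscale (s0 z.1) z.2) * psi0 z.1)%:E.
have mF : measurable_fun setT F.
  by apply/measurable_EFinP; exact: measurable_dilate2.
rewrite (_ : avg c = fun x => (\int[lam]_t F^\+ (t, x) -
    \int[lam]_t F^\- (t, x))%E); last first.
  apply/funext => x; rewrite /avg integralE; congr (_ - _)%E;
  by apply: eq_integral => t _; rewrite ?funeposE ?funenegE.
apply: emeasurable_funB.
  exact: (measurable_fun_fubini_tonelli_G _ (measurable_funepos mF)
    (funepos_ge0 _)).
exact: (measurable_fun_fubini_tonelli_G _ (measurable_funeneg mF)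
  (funeneg_ge0 _)).
Qed.

Lemma measurable_fine_avg (c : borelRn R n -> R) : measurable_fun setT c ->
  measurable_fun setT (fun x => fine (avg c x)).
Proof.
move=> mc; exact: (measurableT_comp (fine_measurable measurableT)
  (measurable_avg mc)).
Qed.

Variables s psi : R -> R.
Hypothesis psi0_out : forall t, ~ unit_itv t -> psi0 t = 0.
Hypothesis rep : {ae @leb1 R, forall t,
  unit_itv t -> s t = s0 t /\ psi t = psi0 t}.

(** By [ae_avoid], for almost every x the integrand of the operator agrees with
    its Borel version for almost every t. *)
Lemma hardy_cesaro_representative (f : n.-tuple R -> R[i])
    (f0 : borelRn R n -> R[i]) :
  cmeasurable_fun setT f0 -> {ae lebesgueRn n, forall x, f x = f0 x} ->
  {ae lebesgueRn n, forall x,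
    hardy_cesaro psi s f x = Complex (fine (avg (fun y => complex.Re (f0 y)) x))
                                    (fine (avg (fun y => complex.Im (f0 y)) x)) /\
    ((avg (fun y => normc (f0 y)) x < +oo)%E ->
     cintegrable leb1 unit_itv (hc_integrand psi s f x) /\
     ((normc (hardy_cesaro psi s f x))%:E <= avg (fun y => normc (f0 y)) x)%E)}.
Proof.
move=> mf0 /(completion_ae (completion_lebesgueRn n)) [Z [mZ Z0 fZ]].
have := ae_completion (completion_lebesgueRn n) (ae_avoid mZ Z0).
apply: ae_mono => x /(ae_completion completion_leb1) Zx.
have {Zx} E : {ae leb1, forall t, unit_itv t ->
    hc_integrand psi s f x t = f0 (tscale (s0 t) x) * (psi0 t)%:C%C}.
  apply: ae_mono2 Zx rep => t nZ + tI => /(_ tI)[st psit].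
  rewrite /hc_integrand st psit; congr (_ * _); apply: contrapT => /fZ.
  exact: nZ.
have [mr mi] := mf0.
have mN : measurable_fun setT (fun y => normc (f0 y)) := measurable_normc mf0.
have ReMr (z : R[i]) (c : R) : complex.Re (z * c%:C%C) = complex.Re z * c.
  by case: z => u v /=; rewrite mulr0 subr0.
have ImMr (z : R[i]) (c : R) : complex.Im (z * c%:C%C) = complex.Im z * c.
  by case: z => u v /=; rewrite mulr0 add0r.
have normcMr (z : R[i]) (c : R) : 0 <= c -> normc (z * c%:C%C) = normc z * c.
  by move=> c0; rewrite Normc.normcM /= expr0n/= addr0 sqrtr_sqr ger0_norm.
have transport (h : R[i] -> R) : measurable_fun setT (fun y => h (f0 y)) ->
    (forall z t, h (z * (psi0 t)%:C%C) = h z * psi0 t) ->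
    measurable_fun unit_itv
      ((fun t => h (hc_integrand psi s f x t)) : Rline R -> R) /\
    (\int[leb1]_(t in unit_itv) (h (hc_integrand psi s f x t))%:E =
     avg (fun y => h (f0 y)) x)%E.
  move=> mh hM; apply: (unit_integral_representative (measurable_dilate x mh)).
    by move=> t tI; rewrite psi0_out// mulr0.
  by apply: ae_mono E => t Et /Et ->; exact: hM.
have [mR IR] := transport _ mr (fun z t => ReMr z (psi0 t)).
have [mI II] := transport _ mi (fun z t => ImMr z (psi0 t)).
have [mNf INf] := transport _ mN (fun z t => normcMr z _ (psi0_ge0 t)).
split; first by rewrite /hardy_cesaro /cintegral /Rintegral IR II.
move=> Goo.
have mU := @measurable_unit_itv R.
have dominated (u : Rline R -> R) : measurable_fun unit_itv u ->
    (forall t, `|u t| <= normc (hc_integrand psi s f x t)) ->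
    leb1.-integrable unit_itv (fun t => (u t)%:E).
  move=> mu' uN; apply/integrableP; split; first exact/measurable_EFinP.
  apply: le_lt_trans Goo; rewrite -INf; apply: (ge0_le_integral _ mU).
  - by move=> t _; exact: abse_ge0.
  - by apply/measurable_EFinP; exact: measurableT_comp.
  - exact/measurable_EFinP.
  - by move=> t _; rewrite lee_fin.
have CI : cintegrable leb1 unit_itv (hc_integrand psi s f x).
  by split; apply: dominated => // t;
    [exact: normr_Re_le_normc|exact: normr_Im_le_normc].
split => //; rewrite -INf; exact: normc_cintegral_le.
Qed.

End operator.

(** * Upper bound *)

Section upper.
Context {R : realType} (n : nat).
Notation lam := (@lebesgue_measure R).
Notation mu := (@borel_lebesgue R n).
Variables (alpha : R) (w : n.-tuple R -> R) (psi s : R -> R).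
Hypothesis hw : homogeneous_weight alpha w.
Hypothesis mpsi : measurable_fun unit_itv (psi : Rline R -> measurableTypeR R).
Hypothesis psi_ge0 : forall t, unit_itv t -> 0 <= psi t.
Hypothesis ms : measurable_fun unit_itv (s : Rline R -> measurableTypeR R).
Hypothesis s_neq0 : {ae @leb1 R, forall t, unit_itv t -> s t != 0}.

Lemma complex_representative (f : Rn R n -> R[i]) : cmeasurable_fun setT f ->
  exists2 f0 : borelRn R n -> R[i], cmeasurable_fun setT f0 &
    {ae lebesgueRn n, forall x, f x = f0 x}.
Proof.
move=> [mr mi].
have [a0 ma0 ra0] := ae_representative (completion_lebesgueRn n) mr.
have [b0 mb0 ib0] := ae_representative (completion_lebesgueRn n) mi.
exists (fun x => Complex (a0 x) (b0 x)) => //.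
by apply: ae_mono2 ra0 ib0 => x <- <-; case: (f x).
Qed.

(** The measurability and convergence requirements of boundedness that do not
    involve the norm. *)
Definition hc_admissible (f : n.-tuple R -> R[i]) : Prop :=
  {ae lebesgueRn n, forall x, cintegrable leb1 unit_itv (hc_integrand psi s f x)}
  /\ cmeasurable_fun setT (hardy_cesaro psi s f : Rn R n -> R[i]).

Lemma hc_constant_representative (p : \bar R) (s0 psi0 : measurableTypeR R -> R) :
  measurable_fun setT s0 -> measurable_fun setT psi0 ->
  (forall t, ~ unit_itv t -> psi0 t = 0) ->
  {ae @leb1 R, forall t, unit_itv t -> s t = s0 t /\ psi t = psi0 t} ->
  hc_constant n alpha p psi s =
  (\int[lam]_t (`|s0 t| `^ (- hc_exponent n alpha p) * psi0 t)%:E)%E.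
Proof.
move=> ms0 mpsi0 out rep.
rewrite /hc_constant; set e := (- _).
have m0 : measurable_fun setT (fun t => `|s0 t| `^ e * psi0 t).
  apply: measurable_funM => //; apply: (measurableT_comp (measurable_powR e)).
  exact: (measurableT_comp (@normr_measurable R setT) ms0).
have [||_ ->//] := unit_integral_representative m0
  (h := fun t => `|s t| `^ e * psi t).
  by move=> t tI; rewrite out// mulr0.
by apply: ae_mono rep => t + tI => /(_ tI)[-> ->].
Qed.

Lemma cmeasurable_representative (F : Rn R n -> R[i]) (u v : borelRn R n -> R) :
  measurable_fun setT u -> measurable_fun setT v ->
  {ae lebesgueRn n, forall x, F x = Complex (u x) (v x)} ->
  cmeasurable_fun setT F.
Proof.
move=> mu' mv E; split.
- apply: (completion_measurable (completion_lebesgueRn n) mu').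
  by apply: ae_mono E => x ->.
- apply: (completion_measurable (completion_lebesgueRn n) mv).
  by apply: ae_mono E => x ->.
Qed.

(** Besides the norm bound, [averaging_bound] gives convergence: the r-th power
    of the average of |f0| becomes integrable when multiplied by an almost
    everywhere positive weight, so this average is finite almost everywhere. *)
Lemma hc_upper_finite (r : R) (f : n.-tuple R -> R[i]) : 1 <= r ->
  (hc_constant n alpha r%:E psi s < +oo)%E -> Lp w r%:E f ->
  hc_admissible f /\
  (Lp_norm w r%:E (hardy_cesaro psi s f) <=
   hc_constant n alpha r%:E psi s * Lp_norm w r%:E f)%E.
Proof.
move=> r1 Koo [mf foo].
have r0 : 0 < r by exact: lt_le_trans r1.
have [s0 [psi0 [ms0 mpsi0 s00 psi00 [out rep]]]] :=
  line_representatives ms mpsi psi_ge0 s_neq0.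
have KE := hc_constant_representative r%:E ms0 mpsi0 out rep.
have [w0 [mw0 w0_ge0 ww0 hom]] := weight_representative hw.
have [f0 mf0 ff0] := complex_representative mf.
pose g := fun y => normc (f0 y).
have mg : measurable_fun setT g by exact: measurable_normc.
have g0 y : 0 <= g y by exact: normc_nneg.
pose I := (\int[mu]_x (g x `^ r * w0 x)%:E)%E.
have mgw (c : borelRn R n -> R) : measurable_fun setT c ->
    measurable_fun setT (fun x => c x `^ r * w0 x).
  move=> mc; apply: measurable_funM => //.
  exact: (measurableT_comp (measurable_powR r) mc).
have fI : Lp_norm w r%:E f = (I `^ r^-1)%E.
  rewrite /Lp_norm; congr poweR.
  apply: (integral_representative (completion_lebesgueRn n) (mgw _ mg)).
  by apply: ae_mono2 ff0 ww0 => x -> [-> _].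
have I0 : (0 <= I)%E.
  by apply: integral_ge0 => x _; rewrite lee_fin mulr_ge0 ?powR_ge0.
have Ioo : (I < +oo)%E.
  by move: foo; rewrite fI; apply: lty_poweRy; rewrite invr_neq0 ?gt_eqF.
rewrite KE in Koo *; set K := (\int[lam]_t _)%E in Koo *.
have K0 : (0 <= K)%E.
  by apply: integral_ge0 => t _; rewrite lee_fin mulr_ge0 ?powR_ge0.
have B := averaging_bound r1 mw0 w0_ge0 hom mg g0 ms0 s00 mpsi0 psi00 Koo.
rewrite -[X in (_ <= X)%E]/(K `^ r * I)%E in B.
have mG := measurable_avg ms0 mpsi0 mg.
pose H x := (avg s0 psi0 g x `^ r * (w0 x)%:E)%E.
have mH : measurable_fun setT H.
  apply: emeasurable_funM; last exact/measurable_EFinP.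
  exact: (measurableT_comp (measurable_poweR r) mG).
have H0 x : (0 <= H x)%E by rewrite mule_ge0 ?poweR_ge0 ?lee_fin.
have iH : mu.-integrable setT H.
  apply/integrableP; split => //; under eq_integral do rewrite gee0_abs ?H0//.
  apply: (le_lt_trans B); rewrite lte_mul_pinfty ?poweR_ge0 ?fin_num_poweR//.
  by rewrite ge0_fin_numE.
have Gfin : {ae lebesgueRn n, forall x, (avg s0 psi0 g x < +oo)%E}.
  have := ae_completion (completion_lebesgueRn n) (integrable_ae measurableT iH).
  apply: ae_mono2 ww0 => x [_ wx] /(_ Logic.I).
  rewrite /H ltey; apply: contraTN => /eqP ->.
  by rewrite /= gt_eqF// mulyr gtr0_sg// mul1e.
have U := hardy_cesaro_representative ms0 s00 mpsi0 psi00 out rep mf0 ff0.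
have mV := measurable_fine_avg ms0 mpsi0.
have [mr mi] := mf0.
pose V x : R[i] := Complex (fine (avg s0 psi0 (fun y => complex.Re (f0 y)) x))
  (fine (avg s0 psi0 (fun y => complex.Im (f0 y)) x)).
have UV : {ae lebesgueRn n, forall x, hardy_cesaro psi s f x = V x}.
  by apply: ae_mono U => x [].
have mVc : cmeasurable_fun setT (V : borelRn R n -> R[i]).
  by split; apply: mV.
split; first split.
- by apply: ae_mono2 Gfin U => x Gx [_ /(_ Gx)[]].
- by apply: (cmeasurable_representative (mV _ _ mr) (mV _ _ mi)); exact: UV.
rewrite fI.
have -> : Lp_norm w r%:E (hardy_cesaro psi s f) =
    ((\int[mu]_x (normc (V x) `^ r * w0 x)%:E) `^ r^-1)%E.
  rewrite /Lp_norm; congr poweR.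
  apply: (integral_representative (completion_lebesgueRn n)).
    by apply: mgw; exact: measurable_normc.
  by apply: ae_mono2 UV ww0 => x -> [-> _].
have KI : ((K `^ r * I) `^ r^-1 = K * I `^ r^-1)%E.
  by rewrite poweRM ?poweR_ge0// -poweRrM divff ?gt_eqF// poweRe1.
rewrite -KI; apply: gt0_ler_poweR.
- by rewrite invr_ge0 ltW.
- rewrite in_itv/= leey andbT; apply: integral_ge0 => x _.
  by rewrite lee_fin mulr_ge0 ?powR_ge0.
- by rewrite in_itv/= leey andbT mule_ge0 ?poweR_ge0.
apply: le_trans B; apply: ae_ge0_le_integral => //.
- by move=> x _; rewrite lee_fin mulr_ge0 ?powR_ge0.
- by apply/measurable_EFinP; apply: mgw; exact: measurable_normc.
- by move=> x _; exact: H0.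
have UG : {ae lebesgueRn n, forall x, ((normc (V x))%:E <= avg s0 psi0 g x)%E}.
  by apply: ae_mono2 Gfin U => x Gx [UVx /(_ Gx)[_]]; rewrite UVx.
apply: ae_mono (completion_ae (completion_lebesgueRn n) UG) => x VG _.
 rewrite EFinM lee_wpmul2r ?lee_fin//.
rewrite -poweR_EFin; apply: gt0_ler_poweR => //; rewrite ?ltW//.
  by rewrite in_itv/= leey andbT lee_fin sqrtr_ge0.
rewrite in_itv/= leey andbT; apply: integral_ge0 => t _.
by rewrite lee_fin mulr_ge0.
Qed.

(** If |f| <= M off a null set Z, then for almost every x the orbit of x avoids
    Z for almost every t, so the average is at most M times the integral of
    psi. *)
Lemma hc_upper_infinite (f : n.-tuple R -> R[i]) :
  (hc_constant n alpha +oo psi s < +oo)%E -> Lp w +oo%E f ->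
  hc_admissible f /\
  (Lp_norm w +oo (hardy_cesaro psi s f) <=
   hc_constant n alpha +oo psi s * Lp_norm w +oo f)%E.
Proof.
move=> Koo [mf foo].
have [s0 [psi0 [ms0 mpsi0 s00 psi00 [out rep]]]] :=
  line_representatives ms mpsi psi_ge0 s_neq0.
have KE := hc_constant_representative +oo ms0 mpsi0 out rep.
have {}KE : hc_constant n alpha +oo psi s = (\int[lam]_t (psi0 t)%:E)%E.
  rewrite KE; apply: eq_integral => t _.
  by rewrite /hc_exponent oppr0 powRr0 mul1r.
have [f0 mf0 ff0] := complex_representative mf.
have U := hardy_cesaro_representative ms0 s00 mpsi0 psi00 out rep mf0 ff0.
pose g := fun y => normc (f0 y).
have mg : measurable_fun setT g by exact: measurable_normc.
pose M := Lp_norm w +oo f.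
have M0 : (0 <= M)%E.
  apply: ess_sup_gee; first exact: lebesgueRn_setT_gt0.
  by apply: aeW => x; rewrite lee_fin normc_nneg.
have Mfin : M \is a fin_num by rewrite ge0_fin_numE.
have gM : {ae lebesgueRn n, forall x, g x <= fine M}.
  have fM : {ae lebesgueRn n, forall x, ((normc (f x))%:E <= M)%E}.
    exact: ess_sup_ge.
  apply: ae_mono2 ff0 fM => x fx.
  by rewrite /g -fx -lee_fin fineK.
have [Z [mZ Z0 gZ]] := completion_ae (completion_lebesgueRn n) gM.
have Gle : {ae lebesgueRn n, forall x,
    (avg s0 psi0 g x <= hc_constant n alpha +oo psi s * M)%E}.
  have := ae_completion (completion_lebesgueRn n) (ae_avoid ms0 s00 mZ Z0).
  apply: ae_mono => x Zx; rewrite KE -(fineK Mfin) -ge0_integralZr//;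
    last 3 first.
  - exact/measurable_EFinP.
  - by move=> t _; rewrite lee_fin.
  - by rewrite lee_fin fine_ge0.
  rewrite /avg; apply: ae_ge0_le_integral => //.
  - by move=> t _; rewrite lee_fin mulr_ge0 ?normc_nneg.
  - apply/measurable_EFinP; exact: measurable_dilate.
  - by move=> t _; rewrite -EFinM lee_fin mulr_ge0 ?fine_ge0.
  - by apply/measurable_EFinP; exact: measurable_funM.
  apply: ae_mono Zx => t nZ _; rewrite -EFinM lee_fin mulrC ler_wpM2l//.
  by apply: contrapT => ngM; apply: nZ; exact: gZ.
have KM : (hc_constant n alpha +oo psi s * M < +oo)%E.
  rewrite lte_mul_pinfty// KE.
    by apply: integral_ge0 => t _; rewrite lee_fin.
  by rewrite ge0_fin_numE -?KE// KE; apply: integral_ge0 => t _; rewrite lee_fin.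
have UG : {ae lebesgueRn n, forall x,
    cintegrable leb1 unit_itv (hc_integrand psi s f x) /\
    ((normc (hardy_cesaro psi s f x))%:E <= hc_constant n alpha +oo psi s * M)%E}.
  apply: ae_mono2 Gle U => x Gx [_ /(_ (le_lt_trans Gx KM))[ci UGx]].
  by split => //; exact: le_trans Gx.
have [mr mi] := mf0.
have mV := measurable_fine_avg ms0 mpsi0.
split; first split.
- by apply: ae_mono UG => x [].
- apply: (cmeasurable_representative (mV _ _ mr) (mV _ _ mi)).
  by apply: ae_mono U => x [].
- by apply/ess_supP; apply: ae_mono UG => x [].
Qed.

End upper.

(** * Shells and homogeneous densities *)

Section shells.
Context {R : realType} (n : nat).
Hypothesis n_gt0 : (0 < n)%N.
Notation mu := (@borel_lebesgue R n).
Notation leb := (@lebesgueRn R n).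

Lemma enorm_ge0 (x : n.-tuple R) : 0 <= enorm x.
Proof. exact: sqrtr_ge0. Qed.

Lemma enorm_tscale (a : R) (x : n.-tuple R) :
  enorm (tscale a x) = `|a| * enorm x.
Proof.
rewrite /enorm; under eq_bigr do rewrite tnth_mktuple exprMn.
by rewrite -mulr_sumr sqrtrM ?sqr_ge0// sqrtr_sqr.
Qed.

Lemma tnth_le_enorm (x : n.-tuple R) i : `|tnth x i| <= enorm x.
Proof.
rewrite -sqrtr_sqr ler_wsqrtr// (bigD1 i)//= lerDl.
by apply: sumr_ge0 => j _; rewrite sqr_ge0.
Qed.

Definition centered_ball (c : R) : set (borelRn R n) := [set x | enorm x < c].

Lemma measurable_centered_ball c : measurable (centered_ball c).
Proof.
rewrite (_ : centered_ball c = @enorm R n @^-1` `]-oo, c[%classic).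
  by rewrite -[X in measurable X]setTI; exact: measurable_enorm.
by apply/seteqP; split => x /=; rewrite in_itv/=.
Qed.

Lemma borel_lebesgue_ball_lty c : (mu (centered_ball c) < +oo :> \bar R)%E.
Proof.
have [c0|c0] := leP 0 c; last first.
  rewrite (_ : centered_ball c = set0) ?measure0//.
  apply/seteqP; split => // x /= xc.
  by have := le_lt_trans (enorm_ge0 x) (lt_trans xc c0); rewrite ltxx.
apply: (@le_lt_trans _ _ (mu (cube n c))).
  apply: le_measure; rewrite ?inE;
    [exact: measurable_centered_ball|exact: measurable_cube|].
  by move=> x /= xc i; apply: le_trans (tnth_le_enorm x i) (ltW xc).
by rewrite borel_lebesgue_cube// ltry.
Qed.

Lemma borel_lebesgue_ball_gt0 : (0 < mu (centered_ball 1) :> \bar R)%E.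
Proof.
apply: (@lt_le_trans _ _ (mu (cube n n.+1%:R^-1))).
  by rewrite borel_lebesgue_cube// lte_fin exprn_gt0// mulr_gt0.
apply: le_measure; rewrite ?inE;
  [exact: measurable_cube|exact: measurable_centered_ball|].
move=> x /= H; rewrite /centered_ball/= /enorm -[ltRHS]sqrtr1 ltr_sqrt//.
apply: (@le_lt_trans _ _ (\sum_(i < n) n.+1%:R^-1 : R)).
  apply: ler_sum => i _; rewrite -[leLHS]real_normK ?num_real//.
  apply: le_trans (_ : `|tnth x i| * 1 <= _); last by rewrite mulr1.
  rewrite expr2 ler_wpM2l//; apply: le_trans (H i) _.
  by rewrite invf_le1// ler1n.
by rewrite sumr_const card_ord -[_ *+ n]mulr_natl ltr_pdivrMr// mul1r ltr_nat.
Qed.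

(** Otherwise the balls of radii 1 and q would have equal volume, whereas the
    ratio of their volumes is q^n > 1 because n >= 1. *)
Lemma shell_not_null (q : R) : 1 < q ->
  ~ {ae mu, forall x, ~~ (1 <= enorm x < q)}.
Proof.
move=> q1 [A [mA A0 HA]].
have q0 : 0 < q by exact: lt_trans q1.
have := borel_lebesgue_ball_gt0; have := borel_lebesgue_ball_lty 1.
set V := mu (centered_ball 1) => Voo V0.
have Vq : mu (centered_ball q) = ((q ^+ n)%:E * V)%E.
  have := @borel_lebesgue_tscale R n q (centered_ball q) (lt0r_neq0 q0)
    (measurable_centered_ball q).
  rewrite (_ : [set x | _] = centered_ball 1); last first.
    apply/seteqP; split => x; rewrite /centered_ball/= enorm_tscale gtr0_norm//.
      by rewrite gtr_pMr.
    by move=> x1; rewrite gtr_pMr.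
  move=> E; rewrite /V [mu (centered_ball 1)]E muleA -EFinM gtr0_norm//.
  rewrite divff ?mul1e//.
  by rewrite expf_eq0 gt_eqF// andbF.
have : (mu (centered_ball q) <= V :> \bar R)%E.
  apply: (@le_trans _ _ (mu (centered_ball 1 `|` A))).
    apply: le_measure; rewrite ?inE; [exact: measurable_centered_ball| |].
      by apply: measurableU => //; exact: measurable_centered_ball.
    move=> x xq; have [x1|x1] := ltP (enorm x) 1; first by left.
    by right; apply: HA => /=; apply/negP; rewrite negbK x1.
  apply: (@le_trans _ _ (mu (centered_ball 1) + mu A)%E).
    by apply: measureU2 => //; exact: measurable_centered_ball.
  by rewrite A0 adde0.
have Vfin : V \is a fin_num by rewrite ge0_fin_numE// ltW.
rewrite Vq -(fineK Vfin) -EFinM lee_fin; apply/negP; rewrite -ltNge.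
rewrite ltr_pMl ?fine_gt0 ?V0//.
by rewrite exprn_egt1// -lt0n.
Qed.

Lemma ge0_integral_tscale_Rn (a : R) (h : Rn R n -> R) : a != 0 ->
  measurable_fun setT h -> (forall x, 0 <= h x) ->
  (\int[leb]_x (h (tscale a x))%:E = (`|a| ^- n)%:E * \int[leb]_x (h x)%:E)%E.
Proof.
move=> a0 mh h0.
have CR := @completion_lebesgueRn R n.
have [h1 mh1 hh1] := ae_representative CR mh.
pose h2 x := Num.max (h1 x) 0.
have mh2 : measurable_fun setT h2 by exact: measurable_maxr.
have hh2 : {ae leb, forall x, h x = h2 x}.
  by apply: ae_mono hh1 => x E; rewrite /h2 -E; apply/esym/max_idPl; exact: h0.
rewrite (integral_representative CR mh2 hh2).
rewrite -(@ge0_integral_tscale R n a (fun x => (h2 x)%:E))//; last 2 first.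
- exact/measurable_EFinP.
- by move=> x; rewrite lee_fin le_max lexx orbT.
apply: (integral_representative CR (h := fun x => h (tscale a x))
  (h0 := fun x => h2 (tscale a x))).
  exact: (measurableT_comp mh2 (measurable_tscale (n := n) a)).
exact: (ae_completion CR (ae_tscale a0 (completion_ae CR hh2))).
Qed.

End shells.

Section homogeneous_kernel.
Context {R : realType} (n : nat).
Hypothesis n_gt0 : (0 < n)%N.
Notation leb := (@lebesgueRn R n).
Variables (alpha : R) (v : Rn R n -> R).
Hypotheses (mv : measurable_fun setT v) (v_ge0 : forall x, 0 <= v x).
Hypothesis v_gt0 : {ae leb, forall x, 0 < v x}.
Hypothesis v_hom : forall (t : R) (x : n.-tuple R),
  t != 0 -> v (tscale t x) = `|t| `^ alpha * v x.

(** Both sides of the inequality are homogeneous of the same degree, which makes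
    the cone invariant under nonzero dilations; on it the weight is bounded on
    bounded shells. *)
Definition cone (k : R) (x : n.-tuple R) : bool := v x <= k * enorm x `^ alpha.

(** The exponent is that of the r-th power of |x|^-gamma, the formal
    eigenfunction of the operator on L^r(v). *)
Definition shell_density (k b c : R) (x : n.-tuple R) : R :=
  if cone k x && (b <= enorm x < c)
  then enorm x `^ (- (n%:R + alpha)) * v x else 0.

Definition shell_mass (k b c : R) : \bar R :=
  (\int[leb]_x (shell_density k b c x)%:E)%E.

Lemma measurable_enorm_Rn : measurable_fun setT (@enorm R n : Rn R n -> R).
Proof.
exact: (measurableT_comp (measurable_enorm (n := n))
  (compl_measurable (completion_lebesgueRn n))).
Qed.

Lemma measurable_cone k : measurable_fun setT (cone k : Rn R n -> bool).
Proof.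
apply: measurable_fun_ler; first exact: mv.
apply: measurable_funM; first exact: measurable_cst.
exact: (measurableT_comp (measurable_powR alpha) measurable_enorm_Rn).
Qed.

Lemma measurable_shell k b c :
  measurable_fun setT (fun x : Rn R n => cone k x && (b <= enorm x < c)).
Proof.
apply: measurable_and; first exact: measurable_cone.
apply: measurable_and.
- exact: (measurable_fun_ler (measurable_cst _) measurable_enorm_Rn).
- exact: (measurable_fun_ltr measurable_enorm_Rn (measurable_cst _)).
Qed.

Lemma measurable_shell_density k b c :
  measurable_fun setT (shell_density k b c : Rn R n -> R).
Proof.
apply: measurable_fun_ifT.
- exact: measurable_shell.
- apply: measurable_funM; last exact: mv.
  exact: (measurableT_comp (measurable_powR _) measurable_enorm_Rn).
- exact: measurable_cst.
Qed.

Lemma shell_density_ge0 k b c x : 0 <= shell_density k b c x.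
Proof.
by rewrite /shell_density; case: ifP => // _; rewrite mulr_ge0// powR_ge0.
Qed.

Let mshell_density k b c :
  measurable_fun setT ((fun x => (shell_density k b c x)%:E) : Rn R n -> _).
Proof. exact/measurable_EFinP/measurable_shell_density. Qed.

Let eshell_density_ge0 k b c (x : Rn R n) :
  [set: Rn R n] x -> (0 <= (shell_density k b c x)%:E)%E.
Proof. by rewrite lee_fin shell_density_ge0. Qed.

Lemma shell_mass_ge0 k b c : (0 <= shell_mass k b c)%E.
Proof. by apply: integral_ge0 => x _; rewrite lee_fin shell_density_ge0. Qed.

Lemma cone_tscale k a x : a != 0 -> cone k (tscale a x) = cone k x.
Proof.
move=> a0; rewrite /cone (v_hom _ a0) enorm_tscale powRM ?normr_ge0 ?enorm_ge0//.
by rewrite mulrCA ler_pM2l// powR_gt0// normr_gt0.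
Qed.

(** The density |x|^-(n + alpha) v has degree -n, which compensates the degree
    n of Lebesgue measure. *)
Lemma shell_mass_scale k b c a : 0 < a ->
  shell_mass k (a * b) (a * c) = shell_mass k b c.
Proof.
move=> a0; have aN0 : a != 0 by rewrite gt_eqF.
have aV0 : a^-1 != 0 by rewrite invr_neq0.
have kE x : shell_density k (a * b) (a * c) x =
    `|a^-1| ^+ n * shell_density k b c (tscale a^-1 x).
  rewrite /shell_density cone_tscale// enorm_tscale gtr0_norm ?invr_gt0//.
  rewrite ler_pdivlMl// ltr_pdivrMl//; case: ifPn => _; last by rewrite mulr0.
  rewrite (v_hom _ aV0) gtr0_norm ?invr_gt0// powRM ?enorm_ge0 ?invr_ge0 ?ltW//.
  rewrite opprD [a^-1 `^ (- _ - _)]powRD; last by rewrite aV0 implybT.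
  rewrite [a^-1 `^ (- n%:R)]powRN powR_mulrn ?invr_ge0 ?ltW//.
  rewrite [a^-1 `^ (- alpha)]powRN.
  set A := a^-1 `^ alpha.
  have A0 : A != 0 by rewrite gt_eqF// powR_gt0// invr_gt0.
  by field; rewrite A0 expf_neq0.
rewrite /shell_mass; under eq_integral do rewrite kE EFinM.
have mka : measurable_fun setT
    ((fun x => (shell_density k b c (tscale a^-1 x))%:E) : Rn R n -> _).
  apply/measurable_EFinP; apply: eq_measurable_fun (measurable_funM
    (measurable_cst (`|a^-1| ^- n))
    (measurable_shell_density k (a * b) (a * c))) => x _.
  by rewrite /= kE mulKf// expf_neq0// normr_eq0.
rewrite (ge0_integralZl _ measurableT mka); last 2 first.
- by move=> x _; rewrite lee_fin shell_density_ge0.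
- by rewrite lee_fin exprn_ge0.
rewrite (ge0_integral_tscale_Rn aV0 (measurable_shell_density k b c)
  (shell_density_ge0 k b c)).
by rewrite muleA -EFinM divff ?mul1e// expf_neq0// normr_eq0.
Qed.

Lemma shell_massD k b c d : b <= c -> c <= d ->
  (shell_mass k b d = shell_mass k b c + shell_mass k c d)%E.
Proof.
move=> bc cd; rewrite /shell_mass -(ge0_integralD _ measurableT
  (@eshell_density_ge0 k b c) (mshell_density k b c)
  (@eshell_density_ge0 k c d) (mshell_density k c d)).
apply: eq_integral => x _; rewrite -EFinD; congr EFin; rewrite /shell_density.
case: cone => /=; last by rewrite addr0.
have [xc|cx] := ltP (enorm x) c.
  by rewrite (lt_le_trans xc cd)/= addr0.
by rewrite (le_trans bc cx)/= add0r.
Qed.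

(** The shell from 1 to q^m splits into m dilates of the shell from 1 to q. *)
Lemma shell_mass_expn k q m : 1 < q ->
  shell_mass k 1 (q ^+ m) = (m%:R%:E * shell_mass k 1 q)%E.
Proof.
move=> q1; have q0 : 0 < q by exact: lt_trans q1.
elim: m => [|m IH].
  rewrite expr0 mul0e; apply: integral0_eq => x _; rewrite /shell_density.
  by case: ifP => // /and3P[_ x1 /(le_lt_trans x1)]; rewrite ltxx.
have qm1 : 1 <= q ^+ m by rewrite exprn_ege1// ltW.
rewrite (shell_massD k qm1); last by rewrite exprSr ler_peMr ?ltW// exprn_gt0.
have -> : shell_mass k (q ^+ m) (q ^+ m.+1) = shell_mass k 1 q.
  by rewrite exprSr -[X in shell_mass k X]mulr1 shell_mass_scale// exprn_gt0.
rewrite IH -[X in (_ + X)%E]mul1e -ge0_muleDl ?lee_fin//.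
by rewrite -EFinD -natr1.
Qed.

(** On the cone the density is at most k |x|^-n, so at most k for |x| >= 1. *)
Lemma shell_mass_lty k q : 0 <= k -> 0 < q -> (shell_mass k 1 q < +oo)%E.
Proof.
move=> k0 q0.
have mC : measurable (cube n q : set (Rn R n)).
  by have := compl_measurable (completion_lebesgueRn n) measurableT
    (@measurable_cube R n q); rewrite setTI.
apply: (@le_lt_trans _ _ (\int[leb]_x (k * \1_(cube n q) x)%:E)%E).
  apply: (ge0_le_integral _ measurableT (@eshell_density_ge0 k 1 q)
    (mshell_density k 1 q)).
    apply/measurable_EFinP; apply: measurable_funM; first exact: measurable_cst.
    exact: measurable_indic.
  move=> x _; rewrite lee_fin /shell_density.
  case: ifPn => [|_]; last by rewrite mulr_ge0.
  move=> /and3P[Cx x1 xq]; rewrite indicE mem_set; last first.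
    by move=> i; apply: le_trans (tnth_le_enorm x i) (ltW xq).
  have x0 : 0 < enorm x by exact: lt_le_trans x1.
  rewrite mulr1 opprD powRD; last by rewrite (gt_eqF x0) implybT.
  rewrite powR_invn ?enorm_ge0// -mulrA mulrC -[leRHS]mulr1.
  rewrite ler_pM ?mulr_ge0 ?powR_ge0 ?invr_ge0 ?exprn_ge0 ?enorm_ge0//.
    by rewrite powRN mulrC ler_pdivrMr// powR_gt0.
  by rewrite invf_le1 ?exprn_ege1// exprn_gt0.
under eq_integral do rewrite EFinM.
have mI : measurable_fun setT
    ((fun x => (\1_(cube n q) x)%:E) : Rn R n -> \bar R).
  by apply/measurable_EFinP; exact: measurable_indic.
rewrite (ge0_integralZl _ measurableT mI); last 2 first.
- by move=> x _; rewrite lee_fin.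
- by rewrite lee_fin.
rewrite integral_indic ?setIT; last 2 first.
- exact: measurableT.
- exact: mC.
rewrite [X in (_ * X)%E](_ : _ = (borel_lebesgue n (cube n q))); last first.
  exact: (compl_measure (completion_lebesgueRn n) (@measurable_cube R n q)).
by rewrite borel_lebesgue_cube ?ltW// -EFinM ltry.
Qed.

(** The cones exhaust the set where |x| > 0 as k grows, so if all masses
    vanished the whole shell would be null. *)
Lemma shell_mass_gt0 q : 1 < q -> exists k : nat, (0 < shell_mass k%:R 1 q)%E.
Proof.
move=> q1; apply: contrapT => H.
have kern0 (k : nat) : {ae leb, forall x, shell_density k%:R 1 q x = 0}.
  have k0 : shell_mass k%:R 1 q = 0%E.
    apply/eqP; rewrite eq_le shell_mass_ge0 andbT leNgt; apply/negP => kp.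
    by apply: H; exists k.
  have [+ _] := ae_eq_integral_abs leb measurableT (mshell_density k%:R 1 q).
  under eq_integral => x _ do rewrite /= ger0_norm ?shell_density_ge0//.
  by move=> /(_ k0); apply: ae_mono => x /(_ Logic.I) [].
apply: (@shell_not_null R n n_gt0 q q1).
apply: (completion_ae (completion_lebesgueRn n)
  (P := fun x => ~~ (1 <= enorm x < q))).
have all0 : {ae leb, forall x, forall k : nat, shell_density k%:R 1 q x = 0}.
  exact/ae_foralln.
apply: ae_mono2 v_gt0 all0 => x vx0 kx0; apply/negP => /andP[x1 xq].
have x0 : 0 < enorm x by exact: lt_le_trans x1.
(* Any larger k also puts x in the cone. *)
pose k := (Num.truncn (v x / enorm x `^ alpha)).+1.
have := kx0 k; rewrite /shell_density x1 xq andbT.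
have -> : cone k%:R x.
  by rewrite /cone -ler_pdivrMr ?powR_gt0// ltW// truncnS_gt.
by move/eqP; rewrite mulf_eq0 !gt_eqF// powR_gt0.
Qed.

End homogeneous_kernel.

(** * Lower bound *)

Section lower.
Context {R : realType} (n : nat).
Hypothesis n_gt0 : (0 < n)%N.
Notation leb := (@lebesgueRn R n).
Variables (alpha : R) (w : n.-tuple R -> R) (psi s : R -> R).
Hypothesis hw : homogeneous_weight alpha w.
Hypothesis mpsi : measurable_fun unit_itv (psi : Rline R -> measurableTypeR R).
Hypothesis psi_ge0 : forall t, unit_itv t -> 0 <= psi t.
Hypothesis ms : measurable_fun unit_itv (s : Rline R -> measurableTypeR R).
Hypothesis s_neq0 : {ae @leb1 R, forall t, unit_itv t -> s t != 0}.

Let mU := @measurable_unit_itv R.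

Section finite_exponent.
Variables (r : R) (r1 : 1 <= r).
Let gamma := hc_exponent n alpha r%:E.

Let r0 : 0 < r. Proof. exact: lt_le_trans r1. Qed.

Let v (x : Rn R n) : R := `|w x|.

Let mv : measurable_fun setT v.
Proof.
have [mw _ _ _] := hw.
exact: (measurableT_comp (@normr_measurable R setT) mw).
Qed.

Let v_ge0 x : 0 <= v x. Proof. exact: normr_ge0. Qed.

Let vw : {ae leb, forall x, w x = v x /\ 0 < v x}.
Proof.
have [_ w0 _ _] := hw.
by apply: ae_mono w0 => x wx; rewrite /v gtr0_norm.
Qed.

Let v_gt0 : {ae leb, forall x, 0 < v x}.
Proof. by apply: ae_mono vw => x []. Qed.

Let v_hom (t : R) (x : n.-tuple R) :
  t != 0 -> v (tscale t x) = `|t| `^ alpha * v x.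
Proof.
move=> t0; have [_ _ _ hom] := hw.
by rewrite /v hom// normrM ger0_norm// powR_ge0.
Qed.

(** The integrand of the constant, cut off to the parameters whose dilation
    moves a point by at most one shell. *)
Definition hc_truncated (q t : R) : R :=
  if (q^-1 <= `|s t|) && (`|s t| <= q) then `|s t| `^ (- gamma) * psi t else 0.

(** A multiple of the formal eigenfunction |x|^-gamma, cut off to have finite
    norm. *)
Definition extremizer (c k q : R) (m : nat) (x : n.-tuple R) : R :=
  if cone alpha v k x && (1 <= enorm x < q ^+ m)
  then c * enorm x `^ (- gamma) else 0.

Lemma measurable_extremizer c k q m :
  measurable_fun setT (extremizer c k q m : Rn R n -> R).
Proof.
apply: measurable_fun_ifT.
- exact: measurable_shell.
- apply: measurable_funM; first exact: measurable_cst.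
  exact: (measurableT_comp (measurable_powR _) (@measurable_enorm_Rn R n)).
- exact: measurable_cst.
Qed.

Lemma extremizer_ge0 c k q m x : 0 <= c -> 0 <= extremizer c k q m x.
Proof.
by move=> c0; rewrite /extremizer; case: ifP => // _; rewrite mulr_ge0 ?powR_ge0.
Qed.

Lemma hc_exponentM : - gamma * r = - (n%:R + alpha).
Proof. by rewrite mulNr /gamma /hc_exponent divfK// gt_eqF. Qed.

Lemma extremizer_powR c k q m x : 0 <= c ->
  extremizer c k q m x `^ r * v x = c `^ r * shell_density alpha v k 1 (q ^+ m) x.
Proof.
move=> c0; rewrite /extremizer /shell_density; case: ifP => _.
  by rewrite powRM ?powR_ge0// -powRrM hc_exponentM mulrA.
by rewrite powR0 ?gt_eqF// mul0r mulr0.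
Qed.

(** If 1/q <= |s(t)| <= q and x lies in an inner shell, then s(t) x is still in
    the support, where the function is exactly homogeneous. *)
Lemma hc_extremizer_ge (c k q : R) (m : nat) x t : 0 <= c -> 1 < q ->
  unit_itv t -> cone alpha v k x -> q <= enorm x < q ^+ m.+1 ->
  c * enorm x `^ (- gamma) * hc_truncated q t <=
  extremizer c k q m.+2 (tscale (s t) x) * psi t.
Proof.
move=> c0 q1 tI Cx /andP[xq xqm].
have q0 : 0 < q by exact: lt_trans q1.
rewrite /hc_truncated; case: ifPn => [/andP[s1 s2]|_]; last first.
  by rewrite mulr0 mulr_ge0 ?extremizer_ge0 ?psi_ge0.
have as0 : 0 < `|s t| by apply: lt_le_trans s1; rewrite invr_gt0.
have st0 : s t != 0 by rewrite -normr_gt0.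
rewrite /extremizer (cone_tscale v_hom k x st0) Cx enorm_tscale.
have -> : 1 <= `|s t| * enorm x.
  rewrite -(mulVf (lt0r_neq0 q0)); apply: ler_pM s1 xq; last exact: ltW.
  by rewrite invr_ge0 ltW.
have -> : `|s t| * enorm x < q ^+ m.+2.
  rewrite exprS; apply: (@le_lt_trans _ _ (q * enorm x)).
    by apply: ler_wpM2r s2; exact: enorm_ge0.
  by rewrite (ltr_pM2l q0).
rewrite /= powRM ?normr_ge0 ?enorm_ge0//.
set A := enorm x `^ _; set B := `|s t| `^ _.
by rewrite (_ : c * (B * A) * psi t = c * A * (B * psi t)) //; ring.
Qed.

Lemma measurable_hc_truncated q : measurable_fun unit_itv
  (hc_truncated q : Rline R -> R).
Proof.
have mns : measurable_fun unit_itv ((fun t => `|s t|) : Rline R -> R).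
  exact: (measurableT_comp (@normr_measurable R setT) ms).
apply: measurable_fun_if.
- exact: mU.
- apply: measurable_and.
  + exact: (measurable_fun_ler (measurable_cst _) mns).
  + exact: (measurable_fun_ler mns (measurable_cst _)).
- apply: (measurable_funS mU); first by move=> t [].
  apply: measurable_funM; last exact: mpsi.
  exact: (measurableT_comp (measurable_powR _) mns).
- exact: measurable_cst.
Qed.

Lemma hc_truncated_ge0 q t : unit_itv t -> 0 <= hc_truncated q t.
Proof.
move=> tI; rewrite /hc_truncated; case: ifP => // _.
by rewrite mulr_ge0 ?powR_ge0 ?psi_ge0.
Qed.

Variable C : \bar R.
Hypothesis HC : forall f, Lp w r%:E f -> (Lp_norm w r%:E f <= 1)%E ->
  hc_admissible psi s f /\ (Lp_norm w r%:E (hardy_cesaro psi s f) <= C)%E.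

(** The test function is normalised to norm 1. Its r-th power
    has mass 1/(m + 2) on each shell, and on the m inner shells the image is at
    least K_q times the function. *)
Lemma truncated_ratio (q : R) (m : nat) : 1 < q ->
  (0 <= C)%E /\ ((\int[leb1]_(t in unit_itv) (hc_truncated q t)%:E) `^ r *
   (m%:R / m.+2%:R)%:E <= C `^ r)%E.
Proof.
move=> q1; have q0 : 0 < q by exact: lt_trans q1.
have [k kpos] := shell_mass_gt0 n_gt0 alpha mv v_ge0 v_gt0 q1.
have klty := shell_mass_lty alpha mv v_ge0 (ler0n R k) q0.
pose nu := fine (shell_mass alpha v k%:R 1 q).
have nuE : shell_mass alpha v k%:R 1 q = nu%:E.
  by rewrite fineK// ge0_fin_numE// ltW.
have nu0 : 0 < nu by rewrite -lte_fin -nuE.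
(* On the m + 2 shells the r-th power of |x|^-gamma has mass (m + 2) nu. *)
pose c := (m.+2%:R * nu) `^ (- r^-1).
have c0 : 0 < c by rewrite powR_gt0// mulr_gt0.
have cr : c `^ r = (m.+2%:R * nu)^-1.
  rewrite /c -powRrM mulNr mulVf ?gt_eqF// powR_inv1// mulr_ge0// ltW//.
pose e := extremizer c k%:R q m.+2.
pose f (x : n.-tuple R) : R[i] := Complex (e x) 0.
have e0 x : 0 <= e x by rewrite extremizer_ge0// ltW.
have nf x : normc (f x) = e x.
  by rewrite /f/= expr0n/= addr0 sqrtr_sqr ger0_norm.
have mf : cmeasurable_fun setT (f : Rn R n -> R[i]).
  by split; [exact: measurable_extremizer|exact: measurable_cst].
have wv (u : Rn R n -> R) : measurable_fun setT u ->
    (\int[leb]_x (u x `^ r * w x)%:E = \int[leb]_x (u x `^ r * v x)%:E)%E.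
  move=> mu'; have mur : measurable_fun setT (fun x => u x `^ r).
    exact: (measurableT_comp (measurable_powR _) mu').
  have [mw _ _ _] := hw.
  apply: ae_eq_integral.
  - exact: measurableT.
  - by apply/measurable_EFinP; exact: (measurable_funM mur mw).
  - by apply/measurable_EFinP; exact: (measurable_funM mur mv).
  - by apply: ae_mono vw => x [wx _] _; rewrite wx.
have fnorm : Lp_norm w r%:E f = 1%E.
  rewrite /Lp_norm; under eq_integral do rewrite nf.
  rewrite (wv _ (measurable_extremizer c k%:R q m.+2)).
  under eq_integral do rewrite (extremizer_powR _ _ _ _ (ltW c0)) EFinM.
  have mk : measurable_fun setT
      ((fun x => (shell_density alpha v k%:R 1 (q ^+ m.+2) x)%:E)
       : Rn R n -> \bar R).
    exact/measurable_EFinP/measurable_shell_density.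
  rewrite (ge0_integralZl _ measurableT mk); last 2 first.
  - by move=> x _; rewrite lee_fin shell_density_ge0.
  - by rewrite lee_fin powR_ge0.
  rewrite -/(shell_mass _ _ _ _ _) (shell_mass_expn mv v_ge0 v_hom _ _ q1) nuE.
  by rewrite cr -!EFinM mulVf ?poweR1r// mulf_neq0 ?gt_eqF.
have fL : Lp w r%:E f by split => //; rewrite fnorm ltry.
have fnorm1 : (Lp_norm w r%:E f <= 1)%E by rewrite fnorm.
have [[ci [mRe mIm]] UC] := HC fL fnorm1.
set Kq := (\int[leb1]_(t in unit_itv) _)%E.
have Kq0 : (0 <= Kq)%E.
  by apply: integral_ge0 => t tI; rewrite lee_fin hc_truncated_ge0.
have mNU : measurable_fun setT
    ((fun x => normc (hardy_cesaro psi s f x)) : Rn R n -> R).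
  by apply: measurable_normc; split.
pose I := (\int[leb]_x (normc (hardy_cesaro psi s f x) `^ r * v x)%:E)%E.
have I0 : (0 <= I)%E.
  by apply: integral_ge0 => x _; rewrite lee_fin mulr_ge0 ?powR_ge0.
have NE : Lp_norm w r%:E (hardy_cesaro psi s f) = (I `^ r^-1)%E.
  by rewrite /Lp_norm (wv _ mNU).
have N0 : (0 <= Lp_norm w r%:E (hardy_cesaro psi s f))%E by rewrite NE poweR_ge0.
split; first exact: le_trans UC.
have IC : (I <= C `^ r)%E.
  rewrite -[I]poweRe1// -[1%R](mulVf (lt0r_neq0 r0)) poweRrM -NE.
  apply: gt0_ler_poweR => //; first exact: ltW.
    by rewrite in_itv/= leey andbT.
  by rewrite in_itv/= leey andbT (le_trans N0 UC).
apply: le_trans IC.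
have pointwise : {ae leb, forall x, (Kq `^ r *
    ((c `^ r)%:E * (shell_density alpha v k%:R (q * 1) (q * q ^+ m) x)%:E) <=
    (normc (hardy_cesaro psi s f x) `^ r * v x)%:E)%E}.
  apply: ae_mono ci => x [cRe cIm]; rewrite mulr1 /shell_density -exprS.
  case: ifPn => [/andP[Cx xq]|_]; last first.
    by rewrite !mule0 lee_fin mulr_ge0 ?powR_ge0.
  have ReE t : complex.Re (hc_integrand psi s f x t) = e (tscale (s t) x) * psi t.
    by rewrite /hc_integrand /f/= mulr0 subr0.
  have lowU : ((c * enorm x `^ (- gamma))%:E * Kq <=
      (normc (hardy_cesaro psi s f x))%:E)%E.
    apply: (@le_trans _ _ (complex.Re (hardy_cesaro psi s f x))%:E); last first.
      by rewrite lee_fin (le_trans (ler_norm _))// normr_Re_le_normc.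
    have -> : ((complex.Re (hardy_cesaro psi s f x))%:E =
        \int[leb1]_(t in unit_itv) (complex.Re (hc_integrand psi s f x t))%:E)%E.
      by rewrite fineK//; exact: (integrable_fin_num mU cRe).
    rewrite /Kq -(ge0_integralZl _ mU); last 3 first.
    - by apply/measurable_EFinP; exact: measurable_hc_truncated.
    - by move=> t tI; rewrite lee_fin hc_truncated_ge0.
    - by rewrite lee_fin mulr_ge0 ?powR_ge0// ltW.
    apply: (ge0_le_integral _ mU).
    - move=> t tI; rewrite -EFinM lee_fin mulr_ge0 ?hc_truncated_ge0//.
      by rewrite mulr_ge0 ?powR_ge0// ltW.
    - under eq_fun do rewrite -EFinM; apply/measurable_EFinP.
      apply: measurable_funM; first exact: measurable_cst.
      exact: measurable_hc_truncated.
    - exact: measurable_int cRe.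
    - move=> t tI; rewrite -EFinM lee_fin ReE.
      exact: (hc_extremizer_ge (ltW c0) q1 tI Cx xq).
  rewrite -hc_exponentM powRrM; set X := enorm x `^ (- gamma) in lowU *.
  have X0 : 0 <= X by exact: powR_ge0.
  have cX0 : 0 <= c * X by rewrite mulr_ge0// ltW.
  have -> : (Kq `^ r * ((c `^ r)%:E * (X `^ r * v x)%:E) =
      ((c * X)%:E * Kq) `^ r * (v x)%:E)%E.
    rewrite poweRM ?lee_fin ?(ltW c0)// poweR_EFin powRM ?(ltW c0)//.
    by rewrite -EFinM [in RHS](muleC _ (Kq `^ r)%E) -muleA -EFinM mulrA.
  rewrite [X in (_ <= X)%E]EFinM; apply: lee_wpmul2r; first by rewrite lee_fin.
  rewrite -poweR_EFin; apply: gt0_ler_poweR lowU.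
  - exact: ltW.
  - by rewrite in_itv/= leey andbT mule_ge0.
  - by rewrite in_itv/= leey andbT lee_fin sqrtr_ge0.
have mkq := measurable_shell_density alpha mv k%:R (q * 1) (q * q ^+ m).
have mk : measurable_fun setT
    ((fun x => (shell_density alpha v k%:R (q * 1) (q * q ^+ m) x)%:E)
     : Rn R n -> \bar R).
  exact/measurable_EFinP.
have mck : measurable_fun setT ((fun x => (c `^ r)%:E *
    (shell_density alpha v k%:R (q * 1) (q * q ^+ m) x)%:E)%E : Rn R n -> \bar R).
  apply/measurable_EFinP.
  by apply: measurable_funM; [exact: measurable_cst|exact: mkq].
have ck0 (x : Rn R n) : [set: Rn R n] x ->
    (0 <= (c `^ r)%:E * (shell_density alpha v k%:R (q * 1) (q * q ^+ m) x)%:E)%E.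
  by move=> _; rewrite lee_fin mulr_ge0 ?powR_ge0 ?shell_density_ge0.
have <- : (\int[leb]_x (Kq `^ r * ((c `^ r)%:E *
    (shell_density alpha v k%:R (q * 1) (q * q ^+ m) x)%:E)) =
    Kq `^ r * (m%:R / m.+2%:R)%:E)%E.
  rewrite (ge0_integralZl _ measurableT mck) ?poweR_ge0//.
  rewrite (ge0_integralZl _ measurableT mk); last 2 first.
  - by move=> x _; rewrite lee_fin shell_density_ge0.
  - by rewrite lee_fin powR_ge0.
  rewrite -/(shell_mass _ _ _ _ _) (shell_mass_scale mv v_ge0 v_hom _ _ _ q0).
  rewrite (shell_mass_expn mv v_ge0 v_hom _ _ q1) nuE cr -!EFinM.
  by congr (_ * _%:E)%E; rewrite mulrC -mulf_div divff ?mulr1// gt_eqF.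
apply: ae_ge0_le_integral.
- exact: measurableT.
- by move=> x xT; rewrite mule_ge0 ?poweR_ge0 ?ck0.
- by apply: emeasurable_funM; [exact: measurable_cst|exact: mck].
- by move=> x _; rewrite lee_fin mulr_ge0 ?powR_ge0.
- apply/measurable_EFinP; apply: measurable_funM; last exact: mv.
  exact: (measurableT_comp (measurable_powR _) mNU).
- by apply: ae_mono pointwise => x + _.
Qed.

(** Let m tend to infinity in [truncated_ratio]. *)
Lemma truncated_le (q : R) : 1 < q ->
  (\int[leb1]_(t in unit_itv) (hc_truncated q t)%:E <= C)%E.
Proof.
move=> q1; set Kq := (\int[_]_(_ in _) _)%E.
have Kq0 : (0 <= Kq)%E.
  by apply: integral_ge0 => t tI; rewrite lee_fin hc_truncated_ge0.
have ratio m : (Kq `^ r * (m%:R / m.+2%:R)%:E <= C `^ r)%E.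
  by have [] := truncated_ratio m q1.
(* The sign of C is needed because real powers of negative numbers are not
   monotone. *)
have [C0 _] := truncated_ratio 0 q1.
have [->|Coo] := eqVneq C +oo%E; first by rewrite leey.
have Cfin : C \is a fin_num by rewrite ge0_fin_numE// ltey.
have c0 : 0 <= fine C by exact: fine_ge0.
move: ratio; rewrite -(fineK Cfin) poweR_EFin; set c := fine C in c0 * => ratio.
have [Koo|Kfin] := eqVneq Kq +oo%E.
  have := ratio 1%N; rewrite Koo (poweRyr (lt0r_neq0 r0)) gt0_mulye.
    by rewrite leye_eq.
  by rewrite lte_fin divr_gt0.
have {}Kfin : Kq \is a fin_num by rewrite ge0_fin_numE// ltey.
move: ratio; rewrite -(fineK Kfin) poweR_EFin lee_fin; set k := fine Kq => ratio.
have k0 : 0 <= k by exact: fine_ge0.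
rewrite leNgt; apply/negP => ck.
have : c `^ r < k `^ r by apply: gt0_ltr_powR.
set x := k `^ r in ratio *; set y := c `^ r in ratio * => yx.
(* Chosen so that m (x - y) > 2 y, which contradicts x m <= y (m + 2). *)
pose m := (Num.truncn (2 * y / (x - y))).+1.
have := ratio m; rewrite -EFinM lee_fin mulrA ler_pdivrMr// leNgt => /negP; apply.
have xy0 : 0 < x - y by rewrite subr_gt0.
have : 2 * y / (x - y) < m%:R by exact: truncnS_gt.
rewrite ltr_pdivrMr// -(natr1 m.+1) -(natr1 m) => H.
by lra.
Qed.

(** Monotone convergence along q = 2, 3, 4, ...; the truncated integrands
    increase to the full one wherever s does not vanish. *)
Lemma hc_lower_finite : (hc_constant n alpha r%:E psi s <= C)%E.
Proof.
pose g (j : nat) (t : Rline R) := (hc_truncated j.+2%:R t)%:E.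
pose F (t : Rline R) := (if s t == 0 then 0 else `|s t| `^ (- gamma) * psi t).
have gF t : limn (g^~ t) = (F t)%:E.
  rewrite /F; have [st0|st0] := eqVneq (s t) 0.
    rewrite (_ : g^~ t = cst 0%E) ?lim_cst//; apply/funext => j.
    by rewrite /g /hc_truncated st0 normr0 lt_geF ?invr_gt0.
  apply: lim_near_cst => //.
  have as0 : 0 < `|s t| by rewrite normr_gt0.
  near=> j; rewrite /g /hc_truncated.
  have H1 : `|s t| <= j.+2%:R.
    apply: (@le_trans _ _ j%:R); last by rewrite ler_nat -addn2 leq_addr.
    near: j; exact: nbhs_infty_ger.
  have H2 : j.+2%:R^-1 <= `|s t|.
    rewrite -[leRHS]invrK lef_pV2 ?posrE ?invr_gt0//.
    apply: (@le_trans _ _ j%:R); last by rewrite ler_nat -addn2 leq_addr.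
    near: j; exact: nbhs_infty_ger.
  by rewrite H1 H2.
have mg j : measurable_fun unit_itv (g j).
  by apply/measurable_EFinP; exact: measurable_hc_truncated.
have g0 j t : unit_itv t -> (0 <= g j t)%E.
  by move=> tI; rewrite lee_fin hc_truncated_ge0.
have ndg t : unit_itv t -> nondecreasing_seq (g^~ t).
  move=> tI i j ij; rewrite lee_fin /hc_truncated.
  case: ifPn => [/andP[s1 s2]|_]; last exact: hc_truncated_ge0.
  rewrite (le_trans _ s1) ?(le_trans s2)//; first by rewrite ler_nat.
  by rewrite lef_pV2 ?posrE// ler_nat.
have mns : measurable_fun unit_itv ((fun t => `|s t|) : Rline R -> R).
  exact: (measurableT_comp (@normr_measurable R setT) ms).
have mh : measurable_fun unit_itv
    ((fun t => `|s t| `^ (- gamma) * psi t) : Rline R -> R).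
  apply: measurable_funM; last exact: mpsi.
  exact: (measurableT_comp (measurable_powR _) mns).
have -> : hc_constant n alpha r%:E psi s =
    (\int[leb1]_(t in unit_itv) limn (g^~ t))%E.
  apply: ae_eq_integral; first exact: mU.
  - by apply/measurable_EFinP; exact: mh.
  - under eq_fun do rewrite gF; apply/measurable_EFinP.
    apply: measurable_fun_if.
    + exact: mU.
    + exact: (measurable_fun_eqr ms (measurable_cst _)).
    + exact: measurable_cst.
    + by apply: (measurable_funS mU) mh => t [].
  - by apply: ae_mono s_neq0 => t st tI; rewrite gF /F (negbTE (st tI)).
rewrite (monotone_convergence _ mU mg g0 ndg).
apply: lime_le.
  apply: ereal_nondecreasing_is_cvgn => i j ij.
  apply: (ge0_le_integral _ mU (g0 i) (mg i) (mg j)) => t tI.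
  exact: ndg.
by apply: nearW => j; apply: truncated_le; rewrite ltr1n.
Unshelve. all: by end_near. Qed.

End finite_exponent.

(** The image of the constant function 1 is the constant K. *)
Lemma hc_lower_infinite (C : \bar R) :
  (forall f, Lp w +oo%E f -> (Lp_norm w +oo f <= 1)%E ->
   hc_admissible psi s f /\ (Lp_norm w +oo (hardy_cesaro psi s f) <= C)%E) ->
  (hc_constant n alpha +oo psi s <= C)%E.
Proof.
move=> HC.
pose f (x : n.-tuple R) : R[i] := Complex 1 0.
have mf : cmeasurable_fun setT (f : Rn R n -> R[i]).
  by split; exact: measurable_cst.
have nf : Lp_norm w +oo f = 1%E.
  rewrite /Lp_norm (_ : (fun x => _) = cst 1%E).
    by rewrite ess_sup_cst// lebesgueRn_setT_gt0.
  by apply/funext => x; rewrite /f/= expr1n expr0n/= addr0 sqrtr1.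
have [[ci _] UC] : hc_admissible psi s f /\
    (Lp_norm w +oo (hardy_cesaro psi s f) <= C)%E.
  by apply: HC; [split => //|]; rewrite nf// ltry.
have bound : {ae leb, forall x : Rn R n, (hc_constant n alpha +oo psi s <= C)%E}.
  (* Convergence of the integral at one point where the bound C holds is enough,
   and almost every point is such. *)
have UxC : {ae leb, forall x, ((normc (hardy_cesaro psi s f x))%:E <= C)%E}.
    by apply/ess_supP.
  apply: ae_mono2 ci UxC => x [cRe _]; apply: le_trans.
  apply: (@le_trans _ _ (complex.Re (hardy_cesaro psi s f x))%:E); last first.
    by rewrite lee_fin (le_trans (ler_norm _))// normr_Re_le_normc.
  have -> : ((complex.Re (hardy_cesaro psi s f x))%:E =
      \int[leb1]_(t in unit_itv) (complex.Re (hc_integrand psi s f x t))%:E)%E.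
    by rewrite fineK//; exact: (integrable_fin_num mU cRe).
  rewrite le_eqVlt; apply/orP; left; apply/eqP; apply: eq_integral => t _.
  by rewrite /hc_exponent oppr0 powRr0/= mul0r subr0.
apply: contrapT => nKC; case: bound => A [mA A0 sub].
have AT : A = setT by apply/seteqP; split => // x _; exact: sub.
by have := lebesgueRn_setT_gt0 (R := R) n; rewrite -AT A0 ltxx.
Qed.

End lower.

(** * Operator norm *)

Section operator_norm.
Context {R : realType} (n : nat).
Variables (w : n.-tuple R -> R) (p : \bar R) (psi s : R -> R) (K : \bar R).
Local Open Scope ereal_scope.
Hypothesis upper : K < +oo -> forall f, Lp w p f -> hc_admissible psi s f /\
  Lp_norm w p (hardy_cesaro psi s f) <= K * Lp_norm w p f.
Hypothesis lower : forall C, (forall f, Lp w p f -> Lp_norm w p f <= 1 ->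
  hc_admissible psi s f /\ Lp_norm w p (hardy_cesaro psi s f) <= C) -> K <= C.
Hypothesis K0 : 0 <= K.

Lemma Lp_norm_ge0 f : 0 <= Lp_norm w p f.
Proof.
case: p => [r| |]/=; first exact: poweR_ge0.
  apply: ess_sup_gee; first exact: lebesgueRn_setT_gt0.
  by apply: aeW => x; rewrite lee_fin normc_nneg.
by [].
Qed.

(** For an arbitrary constant C in the definition of boundedness, the positive
    part of C bounds the image of the unit ball, to which the lower bound
    applies. *)
Lemma hc_boundedP : hc_bounded psi s w p <-> K < +oo.
Proof.
split=> [[Lf [C HC]]|Koo].
  apply: (@le_lt_trans _ _ (Num.max C 0)%:E); last exact: ltry.
  apply: lower => f fL f1; have [ci [mU _]] := Lf f fL; split => //.
  apply: le_trans (HC f fL) _.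
  apply: (@le_trans _ _ ((Num.max C 0)%:E * Lp_norm w p f)).
    by apply: lee_wpmul2r; [exact: Lp_norm_ge0|rewrite lee_fin le_max lexx].
  rewrite -[leRHS]mule1; apply: lee_wpmul2l => //.
  by rewrite lee_fin le_max lexx orbT.
have Kfin : K \is a fin_num by rewrite ge0_fin_numE.
split.
  move=> f fL; have [[ci mU] Ule] := upper Koo fL; split => //; split => //.
  apply: le_lt_trans Ule _; apply: lte_mul_pinfty => //.
  by have [] := fL.
by exists (fine K) => f fL; rewrite fineK//; have [] := upper Koo fL.
Qed.

Lemma hc_opnormE : K < +oo -> hc_opnorm psi s w p = K.
Proof.
move=> Koo; apply/eqP; rewrite eq_le; apply/andP; split.
  apply: ge_ereal_sup => _ [f [fL f1] <-].
  have [_ Ule] := upper Koo fL; apply: le_trans Ule _.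
  by rewrite -[leRHS]mule1; apply: lee_wpmul2l.
apply: lower => f fL f1; have [adm _] := upper Koo fL; split => //.
by apply: ereal_sup_ubound; exists f.
Qed.

End operator_norm.

Theorem theorem2p3 (R : realType) (n : nat) (hn : (1 <= n)%N) (p : \bar R)
    (hp : (1 <= p)%E) (alpha : R) (w : n.-tuple R -> R)
    (hw : homogeneous_weight alpha w) (psi s : R -> R)
    (mpsi : measurable_fun unit_itv (psi : Rline R -> measurableTypeR R))
    (psi_ge0 : forall t, unit_itv t -> 0 <= psi t)
    (ms : measurable_fun unit_itv (s : Rline R -> measurableTypeR R))
    (hs : exists2 beta : R, 0 < beta &
      {ae @leb1 R, forall t, unit_itv t -> t `^ beta <= `|s t|}) :
  (hc_bounded psi s w p <-> (hc_constant n alpha p psi s < +oo)%E) /\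
  ((hc_constant n alpha p psi s < +oo)%E ->
   hc_opnorm psi s w p = hc_constant n alpha p psi s).
Proof.
have s_neq0 : {ae @leb1 R, forall t, unit_itv t -> s t != 0}.
  have [beta beta0 hb] := hs.
  have t_neq0 : {ae @leb1 R, forall t : Rline R, t != 0}.
    apply: (ae_completion completion_leb1 (P := fun t : R => t != 0)).
    exists [set 0]; split; first exact: measurable_set1.
      exact: lebesgue_measure_set1.
    by move=> t /= /negP; rewrite negbK => /eqP.
  apply: ae_mono2 t_neq0 hb => t t0 tb tI; rewrite -normr_gt0.
  apply: lt_le_trans (tb tI); apply: powR_gt0.
  by move: tI; rewrite /unit_itv/= in_itv/= lt_neqAle eq_sym t0 => /andP[].
have K0 : (0 <= hc_constant n alpha p psi s)%E.
  by apply: integral_ge0 => t tI; rewrite lee_fin mulr_ge0 ?powR_ge0 ?psi_ge0.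
have [upper lower] :
  ((hc_constant n alpha p psi s < +oo)%E -> forall f, Lp w p f ->
    hc_admissible psi s f /\
    (Lp_norm w p (hardy_cesaro psi s f) <=
     hc_constant n alpha p psi s * Lp_norm w p f)%E) /\
  (forall C, (forall f, Lp w p f -> (Lp_norm w p f <= 1)%E ->
    hc_admissible psi s f /\ (Lp_norm w p (hardy_cesaro psi s f) <= C)%E) ->
    (hc_constant n alpha p psi s <= C)%E).
  case: p hp {K0} => [r r1| _|//]; split.
  - by move=> Koo f fL; exact: hc_upper_finite.
  - by move=> C HC; exact: hc_lower_finite HC.
  - by move=> Koo f fL; exact: hc_upper_infinite.
  - by move=> C HC; exact: hc_lower_infinite HC.
by split; [exact: hc_boundedP|exact: hc_opnormE].
Qed.
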